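(* Let $C$ be a generic hyperelliptic curve of genus $g > 1$ over a field $k$ of characteristic $0$, i.e., the image of the corresponding morphism from $\operatorname{Spec} k$ to the moduli space (over $\mathbb{Q}$) of hyperelliptic curves of genus $g$ is the generic point. Assume that $C$ has a $k$-rational Weierstrass point, and use it to embed $C$ in its Jacobian $J$. Then $C(\overline{k}) \cap J(\overline{k})_{\mathrm{tors}}$ consists of only the Weierstrass points.
   Context: $\overline{k}$ is an algebraic closure of $k$. The embedding $C \to J$ using a rational Weierstrass point $W$ is $P \mapsto [P - W]$, and $J(\overline{k})_{\mathrm{tors}}$ is the torsion subgroup of $J(\overline{k})$. *)

(* Defs.v *)
From HB Require Import structures.
From mathcomp Require Import all_boot all_order all_algebra.
From mathcomp Require Import separable.
From mathcomp Require Export mpoly freeg.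

Set Implicit Arguments.
Unset Strict Implicit.
Unset Printing Implicit Defensive.

Import GRing.Theory.
Local Open Scope ring_scope.

(* A hyperelliptic curve of genus g is given by a double cover
     x : C -> P^1,   y ^ 2 = f(x),
   with f squarefree of degree 2g+1 or 2g+2.  C is the smooth projective
   model, glued from the affine chart (x, y) and the chart at infinity
     (u, v) = (1 / x, y / x ^ (g+1)),  v ^ 2 = \sum_i f_i u ^ (2g+2-i).
   For g > 1 and in characteristic <> 2 every hyperelliptic curve whose
   quotient by the hyperelliptic involution is P^1 is of this form; this
   covers all those having a rational point. *)
Definition hyperelliptic_poly (g : nat) (F : fieldType) (f : {poly F}) : Prop :=
  (size f == g.+1.*2 \/ size f == g.+1.*2.+1) /\ separable_poly f.

(* [Aff a b] is the point (x, y) = (a, b) and [Infty s] is the point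
   (u, v) = (0, s). *)
Variant point (F : Type) := Aff of F & F | Infty of F.

Definition point_code (F : Type) (P : point F) : F * F + F :=
  match P with Aff a b => inl (a, b) | Infty s => inr s end.
Definition point_decode (F : Type) (c : F * F + F) : point F :=
  match c with inl ab => Aff ab.1 ab.2 | inr s => Infty s end.
Lemma point_codeK (F : Type) : cancel (@point_code F) (@point_decode F).
Proof. by case. Qed.

HB.instance Definition _ (F : choiceType) :=
  Choice.copy (point F) (can_type (@point_codeK F)).

Definition on_curve (g : nat) (F : fieldType) (f : {poly F}) (P : point F) :=
  match P with
  | Aff a b => b ^+ 2 == f.[a]
  | Infty s => s ^+ 2 == f`_(g.+1.*2)
  end.

(* The set C(F). *)
Definition curve (g : nat) (F : fieldType) (f : {poly F}) : Type :=
  {P : point F | on_curve g f P}.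
HB.instance Definition _ (g : nat) (F : fieldType) (f : {poly F}) :=
  Choice.on (curve g f).

Definition hyperelliptic_involution (F : fieldType) (P : point F) : point F :=
  match P with Aff a b => Aff a (- b) | Infty s => Infty (- s) end.

Definition weierstrass (g : nat) (F : fieldType) (f : {poly F})
    (P : curve g f) : Prop :=
  hyperelliptic_involution (val P) = val P.

Definition map_point (F E : fieldType) (i : F -> E) (P : point F) : point E :=
  match P with Aff a b => Aff (i a) (i b) | Infty s => Infty (i s) end.

Lemma on_curve_map (g : nat) (F E : fieldType) (i : {rmorphism F -> E})
    (f : {poly F}) (P : point F) :
  on_curve g f P -> on_curve g (map_poly i f) (map_point i P).
Proof.
case: P => [a b|s] /eqP h; apply/eqP.
  by rewrite horner_map -h /= rmorphXn.
by rewrite coef_map -h /= rmorphXn.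
Qed.

(* The inclusion C(F) -> C(E). *)
Definition base_change (g : nat) (F E : fieldType) (i : {rmorphism F -> E})
    (f : {poly F}) (P : curve g f) : curve g (map_poly i f) :=
  exist _ (map_point i (val P)) (on_curve_map i (valP P)).

(* Two-variable polynomials: the inner variable is the first coordinate, the
   outer variable the second one. *)
Definition eval2 (R : nzRingType) (p : {poly {poly R}}) (x y : R) : R :=
  p.[y%:P].[x].

Definition eval2_in (F L : fieldType) (j : {rmorphism F -> L})
    (p : {poly {poly F}}) (z : L * L) : L :=
  eval2 (map_poly (map_poly j) p) z.1 z.2.

Record is_function_field (F L : fieldType) (j : {rmorphism F -> L})
    (f : {poly F}) (x y : L) : Prop := IsFunctionField {
  ff_transcendental : ~ algebraicOver j x;
  ff_equation : y ^+ 2 = (map_poly j f).[x];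
  ff_generated : forall h : L, exists p q : {poly {poly F}},
    eval2_in j q (x, y) != 0 /\ h = eval2_in j p (x, y) / eval2_in j q (x, y)
}.

Section Divisors.

(* F is algebraically closed in the applications, and (L, j, x, y) is the
   function field of y ^ 2 = f(x). *)
Variables (g : nat) (F L : fieldType) (j : {rmorphism F -> L}).
Variables (f : {poly F}) (x y : L).

Definition chart (P : curve g f) : L * L :=
  match val P with
  | Aff _ _ => (x, y)
  | Infty _ => (x^-1, y / x ^+ g.+1)
  end.

Definition center (P : curve g f) : F * F :=
  match val P with
  | Aff a b => (a, b)
  | Infty s => (0, s)
  end.

Definition local_ring (P : curve g f) (h : L) : Prop :=
  exists p q : {poly {poly F}},
    eval2 q (center P).1 (center P).2 != 0 /\
    h = eval2_in j p (chart P) / eval2_in j q (chart P).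

Definition max_ideal (P : curve g f) (h : L) : Prop :=
  exists p q : {poly {poly F}},
    [/\ eval2 q (center P).1 (center P).2 != 0,
        eval2 p (center P).1 (center P).2 = 0
      & h = eval2_in j p (chart P) / eval2_in j q (chart P)].

Definition uniformizer (P : curve g f) (t : L) : Prop :=
  max_ideal P t /\
  forall h, max_ideal P h -> exists2 u, local_ring P u & h = u * t.

(* The function h has order n at P. *)
Definition has_order (P : curve g f) (h : L) (n : int) : Prop :=
  exists t u : L,
    [/\ uniformizer P t, u != 0, local_ring P u, local_ring P u^-1
      & h = u * t ^ n].

Definition principal (D : {freeg (curve g f) / int}) : Prop :=
  exists2 h : L, h != 0 & forall P, has_order P h (coeff P D).

(* The Jacobian is Pic^0 = (divisors of degree 0) / (principal divisors):
   the class of D is a torsion point of it. *)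
Definition jacobian_torsion (D : {freeg (curve g f) / int}) : Prop :=
  deg D = 0 /\ exists2 n : nat, (0 < n)%N & principal (D *+ n).

Definition abel_jacobi (W P : curve g f) : {freeg (curve g f) / int} :=
  << P >> - << W >>.

End Divisors.

(* The moduli space over Q of hyperelliptic curves of genus g is the quotient
   of the open subscheme U of the affine space of (coefficients of) binary
   forms of degree 2g+2 over Q whose points are the forms with nonzero
   discriminant, by the group of changes of coordinates
     x |-> (a x + b) / (c x + d),   y |-> e y / (c x + d) ^ (g+1).
   A polynomial f of degree 2g+1 or 2g+2 is identified with its homogenization
   of degree 2g+2.  As a topological space, the moduli space is the quotient
   of U by the relation "isomorphic over some algebraically closed field": its
   closed subsets are the closed subsets of U stable under isomorphism. *)
Definition hyperelliptic_isom (g : nat) (F : fieldType) (f1 f2 : {poly F})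
    : Prop :=
  exists a b c d e : F,
    [/\ a * d - b * c != 0, e != 0
      & \sum_(i < g.+1.*2.+1)
          f1`_i *: ((a *: 'X + b%:P) ^+ i
                    * (c *: 'X + d%:P) ^+ (g.+1.*2 - i))
        = e ^+ 2 *: f2].

(* f lies in the closed set defined by S. *)
Definition in_zeros (g : nat) (S : {mpoly rat[g.+1.*2.+1]} -> Prop)
    (F : fieldType) (f : {poly F}) : Prop :=
  forall p, S p -> mmap (@ratr F) (fun i : 'I_(g.+1.*2.+1) => f`_i) p = 0.

Definition moduli_closed (g : nat) (S : {mpoly rat[g.+1.*2.+1]} -> Prop)
    : Prop :=
  forall (Omega : closedFieldType) (f1 f2 : {poly Omega}),
    [pchar Omega] =i pred0 ->
    hyperelliptic_poly g f1 -> hyperelliptic_poly g f2 ->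
    hyperelliptic_isom g f1 f2 -> in_zeros S f1 -> in_zeros S f2.

(* The moduli point of y ^ 2 = f(x) is the generic point: every closed subset
   of the moduli space that contains it is the whole space. *)
Definition generic (g : nat) (F : fieldType) (f : {poly F}) : Prop :=
  forall S : {mpoly rat[g.+1.*2.+1]} -> Prop,
    moduli_closed S -> in_zeros S f ->
    forall (Omega : closedFieldType) (h : {poly Omega}),
      [pchar Omega] =i pred0 -> hyperelliptic_poly g h -> in_zeros S h.

(* Main.v *)
Require Import Defs.
From HB Require Import structures.
From mathcomp Require Import all_boot all_order all_algebra.
From mathcomp Require Import separable fraction ring zify.
From mathcomp Require boolp classical_sets.

(** If P - W is torsion of order dividing m, the square of the corresponding
    function, multiplied by a power of x - x(W), has the form A + B y with
    deg A <= m, deg B <= m - g - 1 and A^2 - f B^2 = c l^(2m), where the linear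
    form l vanishes exactly at x(P), and A does not vanish there when P is not
    a Weierstrass point.

    Move f by a generic matrix: by genericity the 2g + 3 coefficients of the
    transform F are algebraically independent over Q, so that every
    infinitesimal deformation of F is d(F) for some derivation d of the
    coefficient field E.  For a derivation D of E[x], such as d/dx or d, the
    equation implies 2 F (A DB - B DA) + A B DF = N_D l^(2m-1) with
    deg N_D <= g + 2.  Reducing modulo F and writing N for N_(d/dx),
      N d(F) = N_d F'  (mod F).
    With G = gcd(N, F), choose d such that N d(F) = G x^i F' (mod F), where
    deg (G x^i) = g + 3.  As g > 1, this is less than deg F, so N_d = G x^i,
    against the bound on deg N_d. *)

Set Implicit Arguments.
Unset Strict Implicit.
Unset Printing Implicit Defensive.

Import GRing.Theory.
Local Open Scope ring_scope.

(** * Deformations of the norm equation *)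

(** Genericity constrains only the moduli point: [f] itself may be normalized, for instance monic of
    degree 2g+1, and then its coefficients satisfy relations. The four independent entries of the
    matrix remove them; [E] is the field of rational functions in these entries over the algebraic
    closure. A derivation prescribed on the coefficients of F extends to [E], but nothing is known
    of its values on the coefficients of A, B and l. The argument therefore uses of N_d only its
    degree and its class modulo F. Modulo F only the term A B D(F) survives, and d/dx serves as a
    second derivation by which the unknown product A B is eliminated. The degree g+3 is the first
    one forbidden to N_d. The function is squared at the start because x is ramified at W: x - x(W)
    has a double zero there and can absorb only even multiples of W. *)

Section LogDerivation.
Variables (E : fieldType) (D : {poly E} -> {poly E}).
Hypothesis DB : {morph D : p q / p - q}.
Hypothesis DM : forall p q, D (p * q) = D p * q + p * D q.

Lemma derivation_exp (p : {poly E}) (n : nat) :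
  D (p ^+ n.+1) = n.+1%:R * p ^+ n * D p.
Proof.
elim: n => [|n IH]; first by rewrite expr1 expr0 !mul1r.
rewrite exprS DM IH [n.+2%:R]mulrS exprS.
move: (D p) (p ^+ n) n.+1%:R => d e m; ring.
Qed.

(* For h = A + B y with y^2 = F, conjugate h' = A - B y and D y = D F / (2 y),
   the quotient of N by C ell y is D h / h - D h' / h'. *)
Lemma log_derivation_numerator (F A B C ell : {poly E}) (n : nat)
    (norm_eq : A ^+ 2 - F * B ^+ 2 = C * ell ^+ n.+1)
    (ell0 : ell != 0) (ellB : coprimep ell B) :
  exists N,
    2%:R * F * (A * D B - D A * B) + A * B * D F = N * ell ^+ n
    /\ B * N = 2%:R * C * D A * ell - A * (D C * ell + n.+1%:R * C * D ell).
Proof.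
(* Multiplication by B eliminates F in favour of the norm, so that [ell ^ n] visibly divides; B is
   prime to [ell] and can be cancelled. *)
have : B * (2%:R * F * (A * D B - D A * B) + A * B * D F)
   = 2%:R * D A * (A ^+ 2 - F * B ^+ 2) - A * D (A ^+ 2 - F * B ^+ 2).
  by rewrite DB DM !derivation_exp; ring.
rewrite norm_eq DM derivation_exp exprS.
move: (_ + _) => M; have := expf_neq0 n ell0; have := @coprimep_expl _ n _ _ ellB.
move: (ell ^+ n) => e eB e0.
move: (D A) (D C) (D ell) n.+1%:R => dA dC dl m BM.
have {}BM : B * M = e * (2%:R * C * dA * ell - A * (dC * ell + m * C * dl)).
  by rewrite BM; ring.
have : e %| M by rewrite -(Gauss_dvdpr _ eB) BM dvdp_mulIl.
move=> /dvdpP [N MN]; exists N; split=> //.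
apply: (mulfI e0); rewrite -BM MN; ring.
Qed.
End LogDerivation.

Section CoefficientwiseDerivation.
Variables (E : fieldType) (d : E -> E).
Hypothesis dB : {morph d : a b / a - b}.
Hypothesis dM : forall a b, d (a * b) = d a * b + a * d b.

Lemma derivation0 : d 0 = 0.
Proof. by rewrite -[in LHS](subrr 0) dB subrr. Qed.

Lemma derivationD : {morph d : a b / a + b}.
Proof.
move=> a b; have dN u : d (- u) = - d u by rewrite -[- u]sub0r dB derivation0 sub0r.
by rewrite -[b in LHS]opprK dB dN opprK.
Qed.

Lemma coef_derivation (p : {poly E}) i : (map_poly d p)`_i = d p`_i.
Proof. exact: coef_map_id0 derivation0. Qed.

Lemma map_derivationB : {morph map_poly d : p q / p - q}.
Proof. by move=> p q; apply/polyP=> i; rewrite !(coefB, coef_derivation). Qed.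

Lemma map_derivationM (p q : {poly E}) :
  map_poly d (p * q) = map_poly d p * q + p * map_poly d q.
Proof.
apply/polyP=> i; rewrite coefD coef_derivation !coefM.
rewrite (big_morph d derivationD derivation0) -big_split /=.
by apply: eq_bigr => k _; rewrite dM !coef_derivation.
Qed.

Lemma size_map_derivation (p : {poly E}) : (size (map_poly d p) <= size p)%N.
Proof. exact: size_poly. Qed.

End CoefficientwiseDerivation.

Lemma size_deriv_le (E : fieldType) (p : {poly E}) : (size p^`() <= size p)%N.
Proof. by apply: leq_trans (size_poly _ _) (leq_pred _). Qed.

(** The left side has degree at most (2g+2) + m + (m-g-1), from which the power of [ell] takes 2m-1.
    [D] is only assumed not to raise sizes, which covers both d/dx and derivations of the
    coefficients. *)
Lemma size_log_derivation_numerator (E : fieldType) (D : {poly E} -> {poly E})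
    (sizeD : forall p, (size (D p) <= size p)%N) (g m : nat)
    (F A B N ell : {poly E}) (sF : (size F <= g.*2 + 3)%N)
    (sA : (size A <= m.+1)%N) (sB : (size B <= m - g)%N) (sl : size ell = 2)
    (NE : 2%:R * F * (A * D B - D A * B) + A * B * D F = N * ell ^+ m.*2.-1) :
  (size N <= g + 3)%N.
Proof.
have [-> |N0] := eqVneq N 0; first by rewrite size_poly0.
(* [m - g] is truncated: for m <= g it is 0 and forces B = 0. Then the left side vanishes, and no
   degree count is needed. *)
have [B0|B0] := eqVneq B 0.
  have DB0 : D B = 0 by apply/eqP; rewrite -size_poly_leq0 (leq_trans (sizeD _)) // B0 size_poly0.
  move: NE; rewrite DB0 B0 !(mulr0, mul0r) subr0 mulr0 addr0 => /esym/eqP.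
  by rewrite mulf_eq0 expf_eq0 (negPf N0) -size_poly_eq0 sl andbF.
have B1 : (0 < size B)%N by rewrite size_poly_gt0.
have l0 : ell != 0 by rewrite -size_poly_gt0 sl.
have se : size (ell ^+ m.*2.-1) = m.*2.
  rewrite -(prednK (n := size _)) ?size_poly_gt0 ?expf_neq0 // size_exp sl mul1n prednK //; lia.
have := size_proper_mul (p := N) (q := ell ^+ m.*2.-1).
rewrite mulf_eq0 !lead_coef_eq0 expf_eq0 (negPf N0) (negPf l0) andbF => /(_ isT).
rewrite se -NE => sN.
suff : (size (2%:R * F * (A * D B - D A * B) + A * B * D F)%R <= m.*2 + g + 2)%N by lia.
have sM (p q : {poly E}) a b : (size p <= a)%N -> (size q <= b)%N -> (size (p * q)%R <= (a + b).-1)%N.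
  by move=> pa qb; apply: leq_trans (size_polyMleq _ _) _; lia.
have sAB (p q : {poly E}) : (size p <= m.+1)%N -> (size q <= m - g)%N -> (size (p * q)%R <= m.*2 - g)%N.
  by move=> h1 h2; apply: leq_trans (sM _ _ _ _ h1 h2) _; lia.
rewrite (leq_trans (size_polyD _ _)) // geq_max; apply/andP; split.
  rewrite -mulrA mulr_natl -scaler_nat; apply: leq_trans (size_scale_leq _ _) _.
  apply: (leq_trans (sM _ _ _ (m.*2 - g)%N sF _)); last lia.
  rewrite (leq_trans (size_polyD _ _)) // geq_max size_polyN !sAB //.
    exact: leq_trans (sizeD _) sA.
  exact: leq_trans (sizeD _) sB.
apply: (leq_trans (sM _ _ _ _ (sAB _ _ sA sB) (leq_trans (sizeD _) sF))); lia.
Qed.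

Lemma no_torsion_equation (E : fieldType) (g m : nat) (c : E)
    (F A B ell : {poly E})
    (E_char0 : [pchar E] =i pred0) (g_gt1 : (1 < g)%N) (m_gt0 : (0 < m)%N)
    (sF : size F = (g.*2 + 3)%N) (sepF : coprimep F F^`())
    (sA : (size A <= m.+1)%N) (sB : (size B <= m - g)%N)
    (sl : size ell = 2) (ellA : coprimep ell A) (c0 : c != 0)
    (norm_eq : A ^+ 2 - F * B ^+ 2 = c%:P * ell ^+ m.*2)
    (deform : forall v : {poly E}, (size v <= g.*2 + 3)%N -> exists d : E -> E,
       [/\ {morph d : a b / a - b}, forall a b, d (a * b) = d a * b + a * d b
         & map_poly d F = v]) : False.
Proof.
have l0 : ell != 0 by rewrite -size_poly_gt0 sl.
have F0 : F != 0 by rewrite -size_poly_gt0 sF; lia.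
have l2m : ell %| c%:P * ell ^+ m.*2.
  by rewrite dvdp_mull // -(prednK (n := m.*2)) ?double_gt0 // exprS dvdp_mulr.
have ellFB : coprimep ell (F * B ^+ 2).
  have -> : F * B ^+ 2 = A ^+ 2 - c%:P * ell ^+ m.*2 by rewrite -norm_eq; ring.
  have [q ->] := dvdpP _ _ l2m.
  by rewrite -mulNr addrC coprimep_addl_mul coprimep_expr.
have [ellF ellB] : coprimep ell F /\ coprimep ell B.
  by move: ellFB; rewrite expr2 !coprimepMr => /and3P[].
have m2 : m.*2.-1.+1 = m.*2 by rewrite prednK ?double_gt0.
have norm_eq' : A ^+ 2 - F * B ^+ 2 = c%:P * ell ^+ m.*2.-1.+1 by rewrite m2.
have derB : {morph (@deriv E) : p q / p - q} by move=> p q; rewrite derivB.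
have derM (p q : {poly E}) : (p * q)^`() = p^`() * q + p * q^`() by rewrite derivM.
have [N [NE BN]] := log_derivation_numerator derB derM norm_eq' l0 ellB.
have sN := size_log_derivation_numerator (@size_deriv_le E) (eq_leq sF) sA sB sl NE.
(* If N = 0, the second identity makes [ell] divide 2m c A ell', hence the nonzero constant 2m c
   ell', as [ell] is prime to A. *)
have N0 : N != 0.
  apply/eqP=> N0; move: BN; rewrite N0 mulr0 derivC mul0r add0r => /esym/eqP.
  rewrite subr_eq0 => /eqP e.
  have : ell %| A * (m.*2.-1.+1%:R * c%:P * ell^`()) by rewrite -e dvdp_mulIr.
  rewrite Gauss_dvdpr // m2 -mulrA => /dvdp_leq; rewrite sl.
  have l'0 : ell^`()`_0 != 0.
    have := lead_coef_eq0 ell; rewrite lead_coefE sl (negPf l0) coef_deriv => /negbT.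
    by rewrite mulr1n.
  have l'n0 : ell^`() != 0 by apply: contraNneq l'0 => ->; rewrite coef0.
  have sl' : (size ell^`() <= 1)%N by apply: leq_trans (size_poly _ _) _; rewrite sl.
  rewrite !mulf_eq0 polyC_eq0 (negPf c0) (negPf l'n0) !orbF.
  have -> : (m.*2%:R == 0 :> {poly E}) = false.
    by rewrite -polyC_natr polyC_eq0 ((pcharf0P E).1 E_char0) double_eq0 gtn_eqF.
  move=> /(_ isT); rewrite mulr_natl -scaler_nat mul_polyC scalerA => h.
  by have := leq_trans h (leq_trans (size_scale_leq _ _) sl').
set G := gcdp N F.
have G0 : G != 0 by rewrite gcdp_eq0 (negPf N0).
have sG : (size G <= g + 3)%N by apply: leq_trans sN; rewrite dvdp_leq // dvdp_gcdl.
have sG0 : (0 < size G)%N by rewrite size_poly_gt0.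
(* Sizes exceed degrees by 1: G X^j gets degree g+3, one above the bound for N_d. As G divides N,
   its degree is at most g+2, so the subtraction is not truncated. *)
pose j := (g + 4 - size G)%N.
have [[u w] /= /eqpP[[c1 c2] /= /andP[c10 c20] Bez]] := Bezoutp N F.
(* Bezout gives u N = G (mod F) up to a scalar, so N v0 = G X^j F' (mod F). The remainder v of v0
   modulo F is small enough to be a deformation of F. *)
pose v0 := c2^-1 *: (c1 *: (u * 'X^j * F^`())).
have Nv0 : F %| N * v0 - G * 'X^j * F^`().
  have -> : G = c2^-1 *: (c1 *: (u * N + w * F)) by rewrite Bez scalerA mulVf // scale1r.
  rewrite /v0 -!mul_polyC; apply/dvdpP; exists (- (c2^-1%:P * (c1%:P * w) * 'X^j * F^`())).
  by move: (_^`()) ('X^j) (_^-1%:P) c1%:P => ? ? ? ?; ring.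
pose v := v0 %% F.
have sv : (size v < size F)%N by rewrite ltn_modp.
have Nv : F %| N * v - G * 'X^j * F^`().
  have -> : N * v - G * 'X^j * F^`() = (N * v0 - G * 'X^j * F^`()) - N * (v0 %/ F) * F.
    by rewrite {1}(divp_eq v0 F) /v; move: ('X^j) F^`() => ? ?; ring.
  by rewrite dvdp_sub // dvdp_mulIr.
have [|d [dB dM dF]] := deform v; first by rewrite -sF ltnW.
have [R [RE _]] := log_derivation_numerator (map_derivationB dB) (map_derivationM dB dM) norm_eq' l0 ellB.
have sR := size_log_derivation_numerator (size_map_derivation d) (eq_leq sF) sA sB sl RE.
(* Modulo F the two numerator equations read A B F' = N ell^(2m-1) and A B v = R ell^(2m-1).
   Cross-multiplication removes A B, and [ell] is prime to F. *)
have RF : F %| N * v - R * F^`().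
  have : F %| ell ^+ m.*2.-1 * (N * v - R * F^`()).
    have -> : ell ^+ m.*2.-1 * (N * v - R * F^`())
        = (N * ell ^+ m.*2.-1) * v - (R * ell ^+ m.*2.-1) * F^`().
      by move: (ell ^+ _) F^`() => ? ?; ring.
    rewrite -NE -RE dF; apply/dvdpP.
    exists (2%:R * (A * B^`() - A^`() * B) * v - 2%:R * (A * map_poly d B - map_poly d A * B) * F^`()).
    by move: (map_poly d A) (map_poly d B) A^`() B^`() F^`() => ? ? ? ? ?; ring.
  by rewrite Gauss_dvdpr // coprimep_expr // coprimep_sym.
have : F %| (R - G * 'X^j) * F^`().
  have -> : (R - G * 'X^j) * F^`() = (N * v - G * 'X^j * F^`()) - (N * v - R * F^`()).
    by move: ('X^j) F^`() => ? ?; ring.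
  exact: dvdp_sub.
rewrite Gauss_dvdpl //.
have sGX : size (G * 'X^j) = (g + 4)%N.
  by rewrite size_mulXn // /j subnK // (leq_trans sG) // leq_add2l.
have sRG : size (R - G * 'X^j) = (g + 4)%N.
  by rewrite addrC size_polyDl size_polyN sGX // addn4 ltnS -addn3.
(* A nonzero multiple of F has size at least 2g+3, but R - G X^j has size g+4, which leaves g <=
   1. *)
move=> /dvdp_leq; rewrite sRG sF -size_poly_gt0 sRG addn_gt0 orbT => /(_ isT).
by rewrite -addnn -addnA leq_add2l; clear -g_gt1; lia.
Qed.

(** * Derivations of fields of characteristic 0 *)

Section RatrChar0.
Variable F : fieldType.
Hypothesis F_char0 : [pchar F] =i pred0.

Lemma intr_char0_eq0 (z : int) : (z%:~R == 0 :> F) = (z == 0).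
Proof.
case: z => n; first by rewrite -pmulrn ((pcharf0P F).1 F_char0).
by rewrite NegzE mulrNz oppr_eq0 -pmulrn ((pcharf0P F).1 F_char0).
Qed.

(** Denominators do not vanish in characteristic 0; once they are cleared, the claim is an identity
    of integers, checked in [rat]. *)
Lemma ratr_char0_zmod_morphism : zmod_morphism (@ratr F).
Proof.
move=> a b; have nz_den r : (denq r)%:~R != 0 :> F by rewrite intr_char0_eq0 denq_eq0.
apply: (canLR (mulfK (nz_den _))); apply: (mulIf (nz_den a)); apply: (mulIf (nz_den b)).
have e : (numq (a - b))%:~R * (denq a)%:~R * (denq b)%:~R
   = ((numq a)%:~R * (denq b)%:~R - (numq b)%:~R * (denq a)%:~R) * (denq (a - b))%:~R :> F.
  rewrite -!intrM -intrB -intrM; congr (_%:~R).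
  apply/eqP; rewrite -(eqr_int rat) !rmorphM rmorphB !rmorphM /= !numqE; apply/eqP; ring.
rewrite e /ratr; have := nz_den a; have := nz_den b.
by move: (denq a)%:~R (denq b)%:~R => x y hx hy; field; rewrite hx hy.
Qed.

Lemma ratr_char0_monoid_morphism : monoid_morphism (@ratr F).
Proof.
have nz_den r : (denq r)%:~R != 0 :> F by rewrite intr_char0_eq0 denq_eq0.
split=> [|a b]; first by rewrite /ratr divr1.
apply: (canLR (mulfK (nz_den _))); apply: (mulIf (nz_den a)); apply: (mulIf (nz_den b)).
have e : (numq (a * b))%:~R * (denq a)%:~R * (denq b)%:~R
   = (numq a)%:~R * (numq b)%:~R * (denq (a * b))%:~R :> F.
  rewrite -!intrM; congr (_%:~R).
  by apply/eqP; rewrite -(eqr_int rat) !rmorphM /= !numqE; apply/eqP; ring.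
rewrite e /ratr; have := nz_den a; have := nz_den b.
by move: (denq a)%:~R (denq b)%:~R => x y hx hy; field; rewrite hx hy.
Qed.

Definition ratr_char0 : {rmorphism rat -> F}.
Proof.
exact: (HB.pack (@ratr F)
  (GRing.isZmodMorphism.Build rat F (@ratr F) ratr_char0_zmod_morphism)
  (GRing.isMonoidMorphism.Build rat F (@ratr F) ratr_char0_monoid_morphism)).
Qed.

Lemma mmap_ratr_char0 (n : nat) (c : 'I_n -> F) (p : {mpoly rat[n]}) :
  mmap ratr_char0 c p = mmap (@ratr F) c p.
Proof. by apply: eq_bigr => m _; rewrite fmorph_eq_rat. Qed.

End RatrChar0.

(* A derivation defined on a subring of E, presented by its graph. *)
Record derivation_graph (E : fieldType) (D : E -> E -> Prop) : Prop := {
  dgraph1 : D 1 0;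
  dgraphB : forall a b u v, D a u -> D b v -> D (a - b) (u - v);
  dgraphM : forall a b u v, D a u -> D b v -> D (a * b) (u * b + a * v);
  dgraph_fun : forall u, D 0 u -> u = 0
}.

Section DerivationGraph.
Variables (E : fieldType) (D : E -> E -> Prop).
Hypothesis Dgraph : derivation_graph D.

Lemma dgraph0 : D 0 0.
Proof. by have := dgraphB Dgraph (dgraph1 Dgraph) (dgraph1 Dgraph); rewrite !subrr. Qed.

Lemma dgraphD a b u v : D a u -> D b v -> D (a + b) (u + v).
Proof.
move=> Da Db; have := dgraphB Dgraph dgraph0 Db; rewrite !sub0r => D_b.
rewrite -[b]opprK -[v]opprK; exact: dgraphB Da D_b.
Qed.

Lemma dgraph_uniq a u v : D a u -> D a v -> u = v.
Proof.
move=> Du Dv; apply/eqP; rewrite -subr_eq0; apply/eqP.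
by apply: (dgraph_fun Dgraph); have := dgraphB Dgraph Du Dv; rewrite subrr.
Qed.

Lemma dgraph_mulrn a u n : D a u -> D (a *+ n) (u *+ n).
Proof.
move=> Da; elim: n => [|n IH]; first exact: dgraph0.
by rewrite !mulrS; exact: dgraphD.
Qed.

Definition coef_graph (p q : {poly E}) := forall i, D p`_i q`_i.

Lemma coef_graphB p q p1 q1 :
  coef_graph p p1 -> coef_graph q q1 -> coef_graph (p - q) (p1 - q1).
Proof. by move=> hp hq i; rewrite !coefB; apply: dgraphB. Qed.

Lemma coef_graphM p q p1 q1 :
  coef_graph p p1 -> coef_graph q q1 -> coef_graph (p * q) (p1 * q + p * q1).
Proof.
move=> hp hq i; rewrite coefD !coefM -big_split /=.
apply: (big_ind2 D) => [|a u b v|k _]; first exact: dgraph0.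
  exact: dgraphD.
exact: (dgraphM Dgraph).
Qed.

Lemma coef_graphC a u : D a u -> coef_graph a%:P u%:P.
Proof. by move=> Da i; rewrite !coefC; case: eqP => // _; exact: dgraph0. Qed.

Lemma coef_graphXn n : coef_graph 'X^n 0.
Proof.
move=> i; rewrite coef0 coefXn; case: eqP => _; [exact: dgraph1 | exact: dgraph0].
Qed.

Lemma coef_graph0l q : coef_graph 0 q -> q = 0.
Proof.
by move=> h; apply/polyP=> i; have := h i; rewrite !coef0; exact: dgraph_fun Dgraph _.
Qed.

Lemma coef_graph_deriv p q : coef_graph p q -> coef_graph p^`() q^`().
Proof. by move=> h i; rewrite !coef_deriv; apply: dgraph_mulrn. Qed.

Hypothesis E_char0 : [pchar E] =i pred0.

(* The value of the derivation at z is forced by an equation of z of minimal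
   degree, and is arbitrary if there is none. *)
Lemma dgraph_extension_value (z : E) : exists z', forall p q,
  coef_graph p q -> p.[z] = 0 -> q.[z] + p^`().[z] * z' = 0.
Proof.
pose annihilator n := exists p q, [/\ coef_graph p q, p.[z] = 0, p != 0 & size p = n].
have [[n annn]|noann] := boolp.EM (exists n, annihilator n); last first.
  exists 0 => p q pq pz; have [p0|p0] := eqVneq p 0; last first.
    by case: noann; exists (size p), p, q.
  by rewrite (coef_graph0l (q := q)) -?p0 // p0 deriv0 !horner0 mul0r addr0.
have /ex_minnP [{annn} k /boolp.asboolP[m [m1 [mm1 mz m0 sm]]] kmin] :
   exists n, boolp.asbool (annihilator n) by exists n; apply/boolp.asboolP.
have small p q : coef_graph p q -> p.[z] = 0 -> (size p < k)%N -> p = 0.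
  move=> pq pz sp; apply/eqP; apply: contraTT sp => p0; rewrite -leqNgt.
  by apply: kmin; apply/boolp.asboolP; exists p, q.
(* The derivative of m also has coefficients in the domain of D and is shorter, so by minimality it
   vanishes at z only if it is 0. In characteristic 0 this would make m a constant. *)
have m'z : m^`().[z] != 0.
  apply/eqP=> m'z; have k0 : (0 < k)%N by rewrite -sm size_poly_gt0.
  have m'0 : m^`() = 0.
    apply: small (coef_graph_deriv mm1) m'z _.
    by apply: leq_ltn_trans (size_poly _ _) _; rewrite sm prednK.
  have /size_poly1P[c c0 mE] : size m == 1.
    have : size m != 0 by rewrite size_poly_eq0.
    case E' : (size m) => [|[|s]] // _.
    have := lead_coef_eq0 m; rewrite (negPf m0) lead_coefE E' /= => /negbT.
    have := coef_deriv m s; rewrite m'0 coef0 -mulr_natr => /esym/eqP.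
    by rewrite mulf_eq0 ((pcharf0P E).1 E_char0) orbF => ->.
  by move: mz; rewrite mE hornerC => /eqP; rewrite (negPf c0).
exists (- m1.[z] / m^`().[z]).
have mz' : m1.[z] + m^`().[z] * (- m1.[z] / m^`().[z]) = 0 by field.
move: (- m1.[z] / _) mz' => z' mz' p.
have [s] := ubnP (size p); elim: s p => // s IH p sp q pq pz.
have [skp|] := leqP k (size p); last first.
  move=> /(small _ _ pq pz) p0.
  by rewrite (coef_graph0l (q := q)) -?p0 // p0 deriv0 !horner0 mul0r addr0.
have p0 : p != 0.
  by rewrite -size_poly_gt0 (leq_trans _ skp) // -sm size_poly_gt0.
pose j := (size p - k)%N.
(* Pseudo-division: the domain of D is only a ring, so p is multiplied by the leading coefficient of
   m before the leading terms cancel. [r1] is the image of r under D, and the claim for p follows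
   from those for r and m. *)
pose r := (lead_coef m)%:P * p - (lead_coef p)%:P * ('X^j * m).
pose r1 := ((m1`_(size m).-1)%:P * p + (lead_coef m)%:P * q)
   - ((q`_(size p).-1)%:P * ('X^j * m) + (lead_coef p)%:P * (0 * m + 'X^j * m1)).
have rr1 : coef_graph r r1.
  apply: coef_graphB.
    by apply: coef_graphM => //; apply: coef_graphC; rewrite lead_coefE.
  apply: coef_graphM; first by apply: coef_graphC; rewrite lead_coefE.
  by apply: coef_graphM => //; exact: coef_graphXn.
have rz : r.[z] = 0 by rewrite /r !(hornerD, hornerN, hornerM) pz mz !mulr0 subrr.
have sXm : size ('X^j * m) = size p.
  by rewrite mulrC size_mulXn // sm /j subnK.
have sr : (size r < size p)%N.
  have sr' : (size r <= size p)%N.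
    rewrite (leq_trans (size_polyD _ _)) // geq_max size_polyN !mul_polyC.
    by rewrite !(leq_trans (size_scale_leq _ _)) // sXm.
  rewrite ltn_neqAle sr' andbT; apply/eqP=> se.
  have : lead_coef r != 0.
    by rewrite lead_coef_eq0 -size_poly_gt0 se size_poly_gt0.
  rewrite lead_coefE se coefB !coefCM -lead_coefE.
  have -> : ('X^j * m)`_(size p).-1 = lead_coef m.
    by rewrite -sXm -lead_coefE lead_coefM lead_coefXn mul1r.
  by rewrite mulrC subrr eqxx.
have := IH r (leq_trans sr sp) r1 rr1 rz.
rewrite /r /r1 derivB !derivM !derivC !(hornerD, hornerN, hornerM, hornerC, hornerXn) mz pz.
move: ('X^j)^`().[z] => dj.
move=> h; have : lead_coef m * (q.[z] + p^`().[z] * z')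
   = lead_coef p * (z ^+ j * (m1.[z] + m^`().[z] * z')).
  by apply/eqP; rewrite -subr_eq0 -h; apply/eqP; ring.
by rewrite mz' !mulr0 => /eqP; rewrite mulf_eq0 lead_coef_eq0 (negPf m0) => /eqP.
Qed.

(** The domain becomes the ring generated by z over the old one, with p(z) sent to p^D(z) + p'(z)
    z'. That this is single-valued is the property of z' just obtained. *)
Lemma dgraph_extension (z : E) : exists D' : E -> E -> Prop,
  [/\ derivation_graph D', forall a u, D a u -> D' a u & exists u, D' z u].
Proof.
have [z' zz'] := dgraph_extension_value z.
exists (fun w u => exists p q, [/\ coef_graph p q, w = p.[z] & u = q.[z] + p^`().[z] * z']).
split; first split.
- exists 1, 0; split; [exact: (coef_graphXn 0) | by rewrite (hornerC 1) |].
  by rewrite derivC !horner0 mul0r addr0.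
- move=> _ _ _ _ [p [p1 [pp1 -> ->]]] [q [q1 [qq1 -> ->]]].
  exists (p - q), (p1 - q1); split; [exact: coef_graphB | by rewrite !(hornerD, hornerN, hornerM)|].
  by rewrite derivB !(hornerD, hornerN); ring.
- move=> _ _ _ _ [p [p1 [pp1 -> ->]]] [q [q1 [qq1 -> ->]]].
  exists (p * q), (p1 * q + p * q1); split; [exact: coef_graphM | by rewrite !(hornerD, hornerN, hornerM)|].
  by rewrite derivM !(hornerD, hornerM); ring.
- by move=> _ [p [q [pq /esym pz ->]]]; exact: zz'.
- move=> a u Da; exists a%:P, u%:P; split; [exact: coef_graphC | by rewrite hornerC |].
  by rewrite derivC !(hornerC, horner0) mul0r addr0.
- exists z', 'X, 0; split; [exact: (coef_graphXn 1) | by rewrite hornerX |].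
  by rewrite derivX horner0 (hornerC 1) mul1r add0r.
Qed.

End DerivationGraph.

(** Zorn's lemma for graphs ordered by inclusion: a maximal one is total, since any further element
    can be adjoined. *)
Lemma dgraph_total_extension (E : fieldType) (D : E -> E -> Prop)
    (E_char0 : [pchar E] =i pred0) (Dgraph : derivation_graph D) :
  exists d : E -> E,
    [/\ {morph d : a b / a - b}, forall a b, d (a * b) = d a * b + a * d b
      & forall a u, D a u -> d a = u].
Proof.
pose ext (D' : E -> E -> Prop) := derivation_graph D' /\ forall a u, D a u -> D' a u.
pose T := {D' | ext D'}.
pose le (s t : T) := boolp.asbool (forall a u, sval s a u -> sval t a u).
pose t0 : T := exist _ D (conj Dgraph (fun a u h => h)).
have [||A totA|[M [Mgraph DM]] Mmax] := @classical_sets.ZL_preorder T t0 le.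
- by move=> t; apply/boolp.asboolP.
- by move=> r s t /boolp.asboolP rs /boolp.asboolP st; apply/boolp.asboolP=> a u /rs/st.
- have [[s0 As0]|noA] := boolp.EM (exists s, A s); last first.
    by exists t0 => s As; case: noA; exists s.
  pose U a u := exists2 s : T, A s & sval s a u.
  have pair a b u v : U a u -> U b v -> exists2 s : T, A s & sval s a u /\ sval s b v.
    move=> [s As sa] [t At tb].
    by case: (totA s t As At) => /boolp.asboolP h; [exists t | exists s] => //; split=> //; exact: h.
  have Uext : ext U.
    split; last by move=> a u Da; exists s0 => //; exact: (svalP s0).2.
    split.
    + by exists s0 => //; exact: dgraph1 (svalP s0).1.
    + move=> a b u v Ua Ub; have [s As [sa sb]] := pair _ _ _ _ Ua Ub.
      by exists s => //; exact: dgraphB (svalP s).1 _ _ _ _ sa sb.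
    + move=> a b u v Ua Ub; have [s As [sa sb]] := pair _ _ _ _ Ua Ub.
      by exists s => //; exact: dgraphM (svalP s).1 _ _ _ _ sa sb.
    + by move=> u [s _ su]; exact: dgraph_fun (svalP s).1 _ su.
  exists (exist _ U Uext) => s As; apply/boolp.asboolP=> a u sa.
  by exists s.
have Mtotal z : exists u, M z u.
  have [M' [M'graph MM' [u M'z]]] := dgraph_extension Mgraph E_char0 z.
  have M'ext : ext M' by split=> // a v /DM/MM'.
  exists u; have : le (exist _ M' M'ext) (exist _ M (conj Mgraph DM)).
    by apply: Mmax; apply/boolp.asboolP.
  by move=> /boolp.asboolP; exact.
have [d Md] := boolp.choice Mtotal.
exists d; split=> [a b|a b|a u /DM Ma]; apply: (dgraph_uniq Mgraph) (Md _) _ => //.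
  exact: dgraphB.
exact: dgraphM.
Qed.

(* The graph that is extended is the formal derivative in the direction v on
   the polynomial ring Q[c]. *)
Lemma derivation_of_alg_indep (E : fieldType) (n : nat) (c v : 'I_n -> E)
    (E_char0 : [pchar E] =i pred0)
    (indep : forall p : {mpoly rat[n]}, mmap (@ratr E) c p = 0 -> p = 0) :
  exists d : E -> E,
    [/\ {morph d : a b / a - b}, forall a b, d (a * b) = d a * b + a * d b
      & forall i, d (c i) = v i].
Proof.
pose ev : {mpoly rat[n]} -> E := mmap (ratr_char0 E_char0) c.
pose D a u := exists2 p, a = ev p & u = \sum_i v i * ev (mderiv i p).
have Dgraph : derivation_graph D.
  split.
  - exists 1; first by rewrite /ev rmorph1.
    by rewrite big1 // => i _; rewrite -mpolyC1 mderivC /ev raddf0 mulr0.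
  - move=> _ _ _ _ [p -> ->] [q -> ->]; exists (p - q); first by rewrite /ev raddfB.
    by rewrite -sumrB; apply: eq_bigr => i _; rewrite mderivB /ev raddfB mulrBr.
  - move=> _ _ _ _ [p -> ->] [q -> ->]; exists (p * q); first by rewrite /ev rmorphM.
    rewrite mulr_suml mulr_sumr -big_split; apply: eq_bigr => i _ /=.
    by rewrite mderivM /ev rmorphD !rmorphM; ring.
  (* Algebraic independence is what makes the formal derivative depend only on the value of the
     polynomial at c. *)
  - move=> u [p pE ->]; have -> : p = 0 by apply: indep; rewrite -(mmap_ratr_char0 E_char0).
    rewrite big1 // => i _.
    by rewrite mderiv0 /ev raddf0 mulr0.
have [d [dB dM dD]] := dgraph_total_extension E_char0 Dgraph.
exists d; split=> // i; apply: dD; exists 'X_i; first by rewrite /ev mmapX mmap1U.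
rewrite (bigD1 i) //= big1 => [|k ki].
  rewrite mderivX mnm1E eqxx scale1r addr0.
  have -> : (U_(i) - U_(i))%MM = 0%MM by apply/mnmP=> k; rewrite mnmBE subnn mnm0E.
  by rewrite mpolyX0 /ev rmorph1 mulr1.
by rewrite mderivX mnm1E eq_sym (negPf ki) scale0r /ev raddf0 mulr0.
Qed.

(** * Binary forms and Moebius transformations *)

Section MpolyNonroot.
Variable F : closedFieldType.

Lemma mcoeff_muni n (p : {mpoly F[n.+1]}) (m : 'X_{1..n.+1}) :
  p@_m = (muni p)`_(m ord_max)@_[multinom m (widen_ord (leqnSn n) i) | i < n].
Proof.
have sep (m1 m2 : 'X_{1..n.+1}) : m1 ord_max = m2 ord_max ->
    [multinom m1 (widen_ord (leqnSn n) i) | i < n]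
      = [multinom m2 (widen_ord (leqnSn n) i) | i < n] -> m1 = m2.
  move=> emax /mnmP ewid; apply/mnmP=> i; have [j|] := unliftP ord_max i; last by move=> ->.
  have -> : lift ord_max j = widen_ord (leqnSn n) j by apply: val_inj; exact: lift_max.
  by move=> ->; have := ewid j; rewrite !mnmE.
rewrite muniE coef_sum raddf_sum /=.
have term (m' : 'X_{1..n.+1}) : (p@_m' *: 'X_[[multinom m' (widen_ord (leqnSn n) i) | i < n]]
     *: 'X^(m' ord_max))`_(m ord_max)@_[multinom m (widen_ord (leqnSn n) i) | i < n]
   = p@_m' * (m' == m)%:R.
  rewrite coefZ coefXn; have [->|ne] := eqVneq m' m.
    by rewrite eqxx !mulr1 mcoeffZ mcoeffX eqxx mulr1.
  rewrite mulr0; case: eqP => [em|_]; last by rewrite mulr0 mcoeff0.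
  rewrite mulr1 mcoeffZ mcoeffX; case: eqP => [ew|_]; last by rewrite mulr0.
  by rewrite (sep m' m) ?eqxx in ne.
rewrite (eq_bigr _ (fun m' _ => term m')).
have [mp|mp] := boolP (m \in msupp p).
  rewrite (bigD1_seq m) //= eqxx mulr1 big1 ?addr0 // => m' /negPf ->.
  by rewrite mulr0.
rewrite (memN_msupp_eq0 mp) big_seq big1 // => m' m'p; case: eqP; last by rewrite mulr0.
by move=> e; rewrite -e m'p in mp.
Qed.

(** Induction on the number of variables: with the other variables fixed, a nonzero polynomial in
    the last one would have a non-root, so its coefficients vanish at every point. *)
Lemma mpoly_eq0_of_meval n (p : {mpoly F[n]}) : (forall v, p.@[v] = 0) -> p = 0.
Proof.
elim: n p => [|n IH] p p0.
  apply/mpolyP=> m; have := p0 (fun=> 0); rewrite mcoeff0 mevalE.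
  have [mp|/memN_msupp_eq0 //] := boolP (m \in msupp p).
  rewrite (bigD1_seq m) //= big_ord0 mulr1 big1 ?addr0 // => m'.
  by rewrite [m']nvar0_mnmE [m]nvar0_mnmE eqxx.
suff mu0 : muni p = 0.
  by apply/mpolyP=> m; rewrite mcoeff_muni mu0 coef0 !mcoeff0.
apply/polyP=> k; rewrite coef0; apply: IH => v'.
have [q0|/closed_nonrootP[t]] := eqVneq (map_poly (meval v') (muni p)) 0.
  by rewrite -(coef_map (meval v')) /= q0 coef0.
case/rootP; pose v i := oapp v' t (unlift ord_max i).
rewrite -[RHS](p0 v) muniE mevalE raddf_sum horner_sum /=.
apply: eq_bigr => m _; rewrite map_polyZ map_polyXn hornerZ hornerXn /=.
rewrite mevalZ mevalX big_ord_recr /= /v unlift_none /= -mulrA; congr (_ * (_ * _)).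
apply: eq_bigr => i _; rewrite mnmE; congr (_ ^+ _).
have -> : widen_ord (leqnSn n) i = lift ord_max i by apply: val_inj; exact/esym/lift_max.
by rewrite liftK.
Qed.

End MpolyNonroot.

Lemma rmorph_mmap (n : nat) (R S T : comNzRingType) (s : {rmorphism S -> T})
    (f : {rmorphism R -> S}) (h : 'I_n -> S) (p : {mpoly R[n]}) :
  s (mmap f h p) = mmap (s \o f) (s \o h) p.
Proof.
rewrite /mmap rmorph_sum; apply: eq_bigr => m _; rewrite rmorphM /mmap1 rmorph_prod.
by congr (_ * _); apply: eq_bigr => i _; rewrite rmorphXn.
Qed.

Lemma eq_mmap (n : nat) (R S : nzRingType) (f f' : R -> S) (h h' : 'I_n -> S) (p : {mpoly R[n]}) :
  f =1 f' -> h =1 h' -> mmap f h p = mmap f' h' p.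
Proof.
move=> ff hh; apply: eq_bigr => m _; rewrite ff; congr (_ * _).
by apply: eq_bigr => i _; rewrite hh.
Qed.

Section Moebius.

(* The action of the matrix [[a, b], [c, d]] on binary forms of degree n, a form
   being given by its dehomogenization. *)
Definition moebius (R : comNzRingType) (n : nat) (a b c d : R) (p : {poly R}) : {poly R} :=
  \sum_(i < n.+1) p`_i *: ((a *: 'X + b%:P) ^+ i * (c *: 'X + d%:P) ^+ (n - i)).

Section Ring.
Variables (R : comNzRingType).
Implicit Types (a b c d : R) (p q : {poly R}).

Lemma moebius_sum n a b c d (I : Type) (r : seq I) (s : I -> R) (F : I -> {poly R}) :
  moebius n a b c d (\sum_(i <- r) s i *: F i) = \sum_(i <- r) s i *: moebius n a b c d (F i).
Proof.
rewrite /moebius; under [RHS]eq_bigr do rewrite scaler_sumr.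
rewrite exchange_big /=; apply: eq_bigr => i _; rewrite coef_sum scaler_suml.
by apply: eq_bigr => k _; rewrite coefZ scalerA.
Qed.

Lemma moebiusB n a b c d p q :
  moebius n a b c d (p - q) = moebius n a b c d p - moebius n a b c d q.
Proof. by rewrite /moebius -sumrB; apply: eq_bigr => i _; rewrite coefB scalerBl. Qed.

Lemma moebiusD n a b c d p q :
  moebius n a b c d (p + q) = moebius n a b c d p + moebius n a b c d q.
Proof. by rewrite /moebius -big_split; apply: eq_bigr => i _; rewrite coefD scalerDl. Qed.

Lemma moebiusZ n a b c d k p : moebius n a b c d (k *: p) = k *: moebius n a b c d p.
Proof. by rewrite /moebius scaler_sumr; apply: eq_bigr => i _; rewrite coefZ scalerA. Qed.

Lemma moebiusXn n a b c d i : (i <= n)%N ->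
  moebius n a b c d 'X^i = (a *: 'X + b%:P) ^+ i * (c *: 'X + d%:P) ^+ (n - i).
Proof.
rewrite -ltnS => lt_in; rewrite /moebius (bigD1 (Ordinal lt_in)) //= coefXn eqxx scale1r.
rewrite big1 ?addr0 // => k; rewrite -val_eqE /= coefXn => /negPf ->.
by rewrite scale0r.
Qed.

Lemma poly_monomials n p : (size p <= n)%N -> p = \sum_(i < n) p`_i *: 'X^i.
Proof.
move=> sp; rewrite -(poly_def n (nth 0 p)); apply/polyP=> i; rewrite coef_poly.
by case: ltnP => // /(leq_trans sp)/(nth_default 0).
Qed.

(** The size bounds say that p and q are forms of degrees n and m; by bilinearity it is enough to
    treat monomials. *)
Lemma moebiusM n m a b c d p q : (size p <= n.+1)%N -> (size q <= m.+1)%N ->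
  moebius (n + m) a b c d (p * q) = moebius n a b c d p * moebius m a b c d q.
Proof.
move=> /poly_monomials pE /poly_monomials qE.
rewrite {1}pE mulr_suml; under eq_bigr do rewrite -scalerAl.
rewrite moebius_sum mulr_suml; apply: eq_bigr => i _.
rewrite -scalerAl; congr (_ *: _).
rewrite {1}qE mulr_sumr; under eq_bigr do rewrite -scalerAr.
rewrite moebius_sum mulr_sumr; apply: eq_bigr => k _.
rewrite -scalerAr; congr (_ *: _).
have [i_le k_le] : (i <= n)%N /\ (k <= m)%N by have := ltn_ord i; have := ltn_ord k; rewrite !ltnS.
rewrite -exprD moebiusXn ?leq_add // (_ : n + m - (i + k) = (n - i) + (m - k))%N; last by lia.
by rewrite !exprD; ring.
Qed.

Lemma moebius0 n a b c d : moebius n a b c d 0 = 0.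
Proof. by rewrite /moebius big1 // => i _; rewrite coef0 scale0r. Qed.

Lemma moebius1 n a b c d : moebius n a b c d 1 = (c *: 'X + d%:P) ^+ n.
Proof. by rewrite -(expr0 'X) moebiusXn // expr0 mul1r subn0. Qed.

Lemma moebius_exp k m a b c d p : (size p <= m.+1)%N ->
  moebius (k * m) a b c d (p ^+ k) = moebius m a b c d p ^+ k.
Proof.
move=> sp; elim: k => [|k IH]; first by rewrite mul0n !expr0 moebius1.
rewrite mulSn !exprS moebiusM ?IH // (leq_trans (size_poly_exp_leq _ _)) // ltnS.
by rewrite mulnC leq_mul2l -subn1 leq_subLR add1n sp orbT.
Qed.

Lemma size_linear a b : (size (a *: 'X + b%:P)%R <= 2)%N.
Proof.
rewrite (leq_trans (size_polyD _ _)) // geq_max (leq_trans (size_scale_leq _ _)) ?size_polyX //.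
by rewrite (leq_trans (size_polyC_leq1 _)).
Qed.

Lemma size_linear_exp a b k : (size ((a *: 'X + b%:P) ^+ k)%R <= k.+1)%N.
Proof.
apply: leq_trans (size_poly_exp_leq _ _) _; rewrite ltnS -[leqRHS]mul1n leq_mul2r.
by have := size_linear a b; case: size => [|[|[|]]] // _; rewrite orbT.
Qed.

(** A, f and B count as forms of degrees m, 2g+2 and m-g-1, so that both terms of the norm have
    degree 2m. If m <= g, truncation of the last degree is harmless because B = 0. *)
Lemma moebius_norm g m a b c d (A B f : {poly R})
    (sf : (size f <= g.+1.*2.+1)%N) (sA : (size A <= m.+1)%N)
    (sB : (size B <= m - g)%N) :
  moebius m.*2 a b c d (A ^+ 2 - f * B ^+ 2)
  = moebius m a b c d A ^+ 2
    - moebius g.+1.*2 a b c d f * moebius (m - g.+1) a b c d B ^+ 2.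
Proof.
rewrite moebiusB -(addnn m) expr2 moebiusM //.
have [->|B0] := eqVneq B 0; first by rewrite expr0n /= mulr0 !moebius0 expr0n mulr0.
have mg : (g < m)%N.
  rewrite ltnNge; apply: contra B0 => le; rewrite -size_poly_leq0 (leq_trans sB) //.
  by rewrite leq_subLR addn0.
have sB' : (size B <= (m - g.+1).+1)%N by rewrite subnSK.
have -> : (m + m = g.+1.*2 + ((m - g.+1) + (m - g.+1)))%N by clear -mg; lia.
rewrite !expr2 !moebiusM //.
apply: leq_trans (size_polyMleq _ _) _; move: sB'; set s := size B; clearbody s.
by clear; lia.
Qed.

Lemma moebius_linear a b c d u v :
  moebius 1 a b c d (u *: 'X + v%:P) = (u * a + v * c) *: 'X + (u * b + v * d)%:P.
Proof.
rewrite moebiusD moebiusZ -{1}(expr1 'X) moebiusXn // -[v%:P]mulr1 mul_polyC moebiusZ moebius1.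
rewrite subnn expr0 !expr1 mulr1 -!mul_polyC !polyCD !polyCM; ring.
Qed.

Lemma size_moebius n a b c d p : (size (moebius n a b c d p) <= n.+1)%N.
Proof.
apply: leq_trans (size_sum _ _ _) _; apply/bigmax_leqP => i _; apply: leq_trans (size_scale_leq _ _) _.
apply: leq_trans (size_polyMleq _ _) _.
have := leq_add (size_linear_exp a b i) (size_linear_exp c d (n - i)%N); have := ltn_ord i; rewrite ltnS.
set x := size _; set y := size _; clearbody x y; lia.
Qed.

(** This is a right action: the matrix of the composite is the inner matrix times the outer one.
    Multiplicativity reduces the claim to linear forms. *)
Lemma moebius_comp n a b c d a' b' c' d' p :
  moebius n a b c d (moebius n a' b' c' d' p)
  = moebius n (a' * a + b' * c) (a' * b + b' * d) (c' * a + d' * c) (c' * b + d' * d) p.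
Proof.
rewrite {2}/moebius moebius_sum; apply: eq_bigr => i _; congr (_ *: _).
have i_le : (i <= n)%N by rewrite -ltnS.
rewrite -{1}(subnKC i_le) moebiusM ?size_linear_exp //.
rewrite -{1}[X in moebius X](muln1 i) -{1}[X in _ * moebius X _ _ _ _ _](muln1 (n - i)%N).
by rewrite !moebius_exp ?size_linear // !moebius_linear.
Qed.

Lemma moebius_scale n s a b c d p :
  moebius n (s * a) (s * b) (s * c) (s * d) p = s ^+ n *: moebius n a b c d p.
Proof.
rewrite /moebius scaler_sumr; apply: eq_bigr => i _; rewrite [RHS]scalerA [s ^+ n * _]mulrC -[RHS]scalerA.
congr (_ *: _); have i_le : (i <= n)%N by rewrite -ltnS.
have e u v : (s * u) *: 'X + (s * v)%:P = s%:P * (u *: 'X + v%:P) :> {poly R}.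
  by rewrite -!mul_polyC !polyCM; ring.
rewrite !e !exprMn mulrACA -exprD subnKC // -[RHS]mul_polyC.
by rewrite rmorphXn.
Qed.

Lemma moebius_id n p : (size p <= n.+1)%N -> moebius n 1 0 0 1 p = p.
Proof.
move=> /poly_monomials {2}->; apply: eq_bigr => i _; congr (_ *: _).
by rewrite scale1r scale0r addr0 add0r expr1n mulr1.
Qed.

End Ring.

Lemma map_moebius (R S : comNzRingType) (s : {rmorphism R -> S}) n a b c d (p : {poly R}) :
  map_poly s (moebius n a b c d p) = moebius n (s a) (s b) (s c) (s d) (map_poly s p).
Proof.
rewrite /moebius rmorph_sum; apply: eq_bigr => i _ /=.
rewrite map_polyZ rmorphM !rmorphXn !rmorphD /= !map_polyZ map_polyX !map_polyC coef_map.
by [].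
Qed.

End Moebius.

(** * Genericity *)

Definition poly_of_coefs (R : nzRingType) (n : nat) (x : 'I_n -> R) : {poly R} :=
  \sum_(i < n) x i *: 'X^i.

Lemma coef_poly_of_coefs (R : nzRingType) n (x : 'I_n -> R) (i : 'I_n) :
  (poly_of_coefs x)`_i = x i.
Proof.
rewrite /poly_of_coefs coef_sum (bigD1 i) //= coefZ coefXn eqxx mulr1 big1 ?addr0 // => k.
by rewrite -val_eqE coefZ coefXn eq_sym => /negPf ->; rewrite mulr0.
Qed.

Lemma size_poly_of_coefs (R : nzRingType) n (x : 'I_n -> R) : (size (poly_of_coefs x) <= n)%N.
Proof.
apply: leq_trans (size_sum _ _ _) _; apply/bigmax_leqP => i _.
by apply: leq_trans (size_scale_leq _ _) _; rewrite size_polyXn.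
Qed.

Lemma poly_of_coefsK (R : comNzRingType) n (p : {poly R}) :
  (size p <= n)%N -> poly_of_coefs (fun i : 'I_n => p`_i) = p.
Proof. by move=> /poly_monomials {2}->. Qed.

Lemma map_poly_of_coefs (R S : nzRingType) (s : {rmorphism R -> S}) n (x : 'I_n -> R) :
  map_poly s (poly_of_coefs x) = poly_of_coefs (s \o x).
Proof. by rewrite rmorph_sum; apply: eq_bigr => i _; rewrite /= map_polyZ map_polyXn. Qed.

Section MoebiusOfGenericForm.
Variable n : nat.
Local Notation R0 := {mpoly rat[n.+1]}.
Local Notation R1 := {mpoly R0[4]}.

(* q evaluated at the coefficients of the transform, by a generic matrix, of
   the generic form of degree n. *)
Definition generic_transform (q : R0) : R1 :=
  mmap (@mpolyC 4 R0 \o @mpolyC n.+1 rat)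
    (fun i => (moebius n 'X_0 'X_1 'X_(2%:R) 'X_(3%:R)
                 (poly_of_coefs (fun k => ('X_k)%:MP : R1)))`_i) q.

Lemma generic_transformE (F : fieldType) (F_char0 : [pchar F] =i pred0) (p : {poly F})
    (v : 'I_4 -> F) (q : R0) : (size p <= n.+1)%N ->
  mmap (mmap (ratr_char0 F_char0) (fun i => p`_i)) v (generic_transform q)
  = mmap (@ratr F) (fun i => (moebius n (v 0) (v 1) (v 2%:R) (v 3%:R) p)`_i) q.
Proof.
move=> sp; rewrite rmorph_mmap; apply: eq_mmap => [r|i].
  by rewrite /= mmapC /= mmapC /= fmorph_eq_rat.
rewrite /= -coef_map map_moebius map_poly_of_coefs /=.
have XE (k : 'I_4) : mmap (mmap (ratr_char0 F_char0) (fun i => p`_i)) v 'X_k = v k.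
  by rewrite mmapX mmap1U.
have CE (k : 'I_n.+1) : mmap (mmap (ratr_char0 F_char0) (fun i => p`_i)) v ('X_k)%:MP = p`_k.
  by rewrite mmapC /= mmapX mmap1U.
rewrite !XE -{2}(poly_of_coefsK sp); congr (moebius _ _ _ _ _ _)`_ _.
by apply: eq_bigr => k _; rewrite -[in RHS]CE.
Qed.

(** As a function of the matrix, q at the transform is a polynomial in four variables. Vanishing at
    all points of a closed field, it vanishes identically, and its coefficients are rational
    conditions on p alone. *)
Lemma generic_transform_coef (K : closedFieldType) (K_char0 : [pchar K] =i pred0)
    (p : {poly K}) (q : R0) (m : 'X_{1..4}) :
  (forall v : 'I_4 -> K,
     mmap (@ratr K) (fun i => (moebius n (v 0) (v 1) (v 2%:R) (v 3%:R) p)`_i) q = 0) ->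
  (size p <= n.+1)%N ->
  mmap (@ratr K) (fun i => p`_i) (generic_transform q)@_m = 0.
Proof.
move=> q0 sp.
rewrite -(mmap_ratr_char0 K_char0).
suff : map_mpoly (mmap (ratr_char0 K_char0) (fun i : 'I_n.+1 => p`_i)) (generic_transform q) = 0.
  by move=> /(congr1 (mcoeff m)); rewrite mcoeff_map_mpoly mcoeff0.
apply: mpoly_eq0_of_meval => v; rewrite -[RHS](q0 v) -generic_transformE //.
rewrite /map_mpoly rmorph_mmap /=; apply: eq_mmap => [r|i] /=; first by rewrite mevalC.
by rewrite mevalXU.
Qed.

End MoebiusOfGenericForm.

(** The rational equations of the orbit of p. Singular matrices are included, so that the entries
    are four free variables and the condition splits into coefficients. *)
Definition orbit_ideal n (K : fieldType) (p : {poly K}) (q : {mpoly rat[n.+1]}) : Prop :=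
  forall a b c d : K, mmap (@ratr K) (fun i : 'I_n.+1 => (moebius n a b c d p)`_i) q = 0.

(** A transform of a transform of p is again a transform of p, so the coefficient conditions hold
    along the whole orbit. *)
Lemma orbit_ideal_coef n (K : closedFieldType) (K_char0 : [pchar K] =i pred0)
    (p : {poly K}) (q : {mpoly rat[n.+1]}) (m : 'X_{1..4}) :
  orbit_ideal p q -> orbit_ideal p (generic_transform q)@_m.
Proof.
move=> pq a b c d; apply: generic_transform_coef => // [v|]; last exact: size_moebius.
rewrite -[RHS](pq (a * v 0 + b * v 2%:R) (a * v 1 + b * v 3%:R)
  (c * v 0 + d * v 2%:R) (c * v 1 + d * v 3%:R)).
by apply: eq_mmap => // i; rewrite moebius_comp.
Qed.

(** [Omega] need not be related to K, so an isomorphism over it cannot be composed with matrices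
    over K. What passes from K to [Omega] are the rational polynomials [(generic_transform q)@_m],
    which the ideal contains along with q. *)
Lemma orbit_ideal_moduli_closed g (K : closedFieldType) (K_char0 : [pchar K] =i pred0)
    (p : {poly K}) : @moduli_closed g (orbit_ideal p).
Proof.
move=> Omega f1 f2 O_char0 hf1 hf2 [a [b [c [d [e [_ e0 isom]]]]]] f1S q pq.
have sf (h : {poly Omega}) : hyperelliptic_poly g h -> (size h <= g.+1.*2.+1)%N.
  by case=> [[/eqP->|/eqP->]].
(* Scaling the matrix by s multiplies a form of degree 2g+2 by s^(2g+2), which absorbs the factor
   e^2. *)
have [s sE] : exists s : Omega, s ^+ g.+1.*2 = (e ^+ 2)^-1.
  have /closed_rootP[s /rootP] : size ('X^(g.+1.*2) - ((e ^+ 2)^-1)%:P : {poly Omega}) != 1%N.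
    by rewrite size_XnsubC.
  by rewrite hornerD hornerN hornerXn hornerC => /eqP; rewrite subr_eq0 => /eqP; exists s.
pose v (i : 'I_4) := nth 0 [:: s * a; s * b; s * c; s * d] i.
have f2E : moebius g.+1.*2 (v 0) (v 1) (v 2%:R) (v 3%:R) f1 = f2.
  rewrite -[LHS]/(moebius _ (s * a) (s * b) (s * c) (s * d) _) moebius_scale sE.
  by rewrite -[moebius _ _ _ _ _ _]/(\sum_(i < _) _) isom scalerA mulVf ?scale1r // expf_neq0.
rewrite -f2E -(generic_transformE O_char0) ?sf //; apply: big1 => m _.
by rewrite mmap_ratr_char0 f1S ?mul0r //; exact: orbit_ideal_coef.
Qed.

(* [map_resultant] only covers morphisms whose source is a polynomial ring. *)
Lemma map_resultant_mx (R S : nzRingType) (s : {rmorphism R -> S}) (p q : {poly R}) :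
    s (lead_coef p) != 0 -> s (lead_coef q) != 0 ->
  s (resultant p q) = resultant (map_poly s p) (map_poly s q).
Proof.
move=> sp sq; rewrite /resultant /Sylvester_mx !size_map_poly_id0 // -det_map_mx map_col_mx.
by congr (\det (col_mx _ _)); apply: map_lin1_mx => v; rewrite map_poly_rV rmorphM /= map_rVpoly.
Qed.

(** D is the resultant of the generic form and its derivative, times the leading coefficient, which
    keeps the degree from dropping. *)
Lemma discriminant_exists (n : nat) : (1 < n)%N ->
  exists2 D : {mpoly rat[n.+1]}, D != 0 &
    forall (F : fieldType) (x : 'I_n.+1 -> F), [pchar F] =i pred0 ->
      mmap (@ratr F) x D != 0 ->
      size (poly_of_coefs x) = n.+1
      /\ coprimep (poly_of_coefs x) (poly_of_coefs x)^`().
Proof.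
move=> n_gt1; pose P := poly_of_coefs (fun i : 'I_n.+1 => 'X_i : {mpoly rat[n.+1]}).
have Pn : P`_n = 'X_ord_max by exact: coef_poly_of_coefs ord_max.
have Xn0 : 'X_ord_max != 0 :> {mpoly rat[n.+1]}.
  by apply/eqP=> /(congr1 (mcoeff U_(ord_max))); rewrite mcoeffX eqxx mcoeff0.
have sP : size P = n.+1.
  apply/eqP; rewrite eqn_leq size_poly_of_coefs ltnNge; apply/negP => h.
  by move: Xn0; rewrite -Pn nth_default ?eqxx.
have P'n : P^`()`_n.-1 = 'X_ord_max *+ n by rewrite coef_deriv prednK ?Pn // ltnW.
have Xn0n : 'X_ord_max *+ n != 0 :> {mpoly rat[n.+1]}.
  apply/eqP=> /(congr1 (mcoeff U_(ord_max))); rewrite mcoeffMn mcoeffX eqxx mcoeff0.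
  by apply/eqP; rewrite Num.Theory.pnatr_eq0 -lt0n ltnW.
have sP' : size P^`() = n.
  have P0 : P != 0 by rewrite -size_poly_gt0 sP.
  have := lt_size_deriv P0; rewrite sP ltnS => sP'.
  apply/eqP; rewrite eqn_leq sP' leqNgt; apply/negP => h.
  by move: Xn0n; rewrite -P'n nth_default ?eqxx // -ltnS prednK // ltnW.
exists (resultant P P^`() * 'X_ord_max).
  rewrite mulf_neq0 //.
  (* The coefficients of X^n - 1: as it is prime to its derivative, the resultant is not the zero
     polynomial. *)
  pose x0 (i : 'I_n.+1) : rat := (i == ord_max)%:R - (i == ord0)%:R.
  have evP : map_poly (meval x0) P = 'X^n - 1.
    rewrite map_poly_of_coefs; apply/polyP => i.
    have [i_lt|i_ge] := ltnP i n.+1; last first.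
      by rewrite !nth_default ?size_XnsubC ?(leq_trans (size_poly_of_coefs _)) // ltnW.
    rewrite (coef_poly_of_coefs _ (Ordinal i_lt)) /= mevalXU /x0 coefB coefXn coef1.
    by rewrite -!val_eqE.
  have evX : meval x0 'X_ord_max != 0.
    have mx0 : (ord_max == ord0 :> 'I_n.+1) = false by apply: gtn_eqF; exact: ltnW.
    by rewrite mevalXU /x0 eqxx mx0 subr0 oner_eq0.
  apply: contraTneq (oner_neq0 rat) => R0.
  have := @map_resultant_mx _ _ (meval x0) P P^`().
  rewrite R0 raddf0 !lead_coefE sP sP' /= Pn P'n -deriv_map evP => /(_ evX).
  rewrite raddfMn /= Num.Theory.mulrn_eq0 negb_or evX andbT -lt0n ltnW // => /(_ isT)/esym/eqP.
  rewrite resultant_eq0 derivB derivXn derivC subr0 ltnNge => /negP[].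
  suff /eqP-> : coprimep ('X^n - 1 : {poly rat}) ('X^(n.-1) *+ n) by [].
  apply/Bezout_coprimepP; exists (- 1, n%:R^-1 *: 'X) => /=.
  have -> : -1 * ('X^n - 1) + n%:R^-1 *: 'X * ('X^(n.-1) *+ n) = 1 :> {poly rat}.
    rewrite -scaler_nat -scalerAl -scalerAr scalerA mulVf ?Num.Theory.pnatr_eq0; last by rewrite -lt0n ltnW.
    by rewrite scale1r -exprS prednK ?(ltnW n_gt1) // mulN1r opprB subrK.
  exact: eqpxx.
move=> F x F_char0; rewrite -(mmap_ratr_char0 F_char0) rmorphM mulf_eq0 negb_or /= mmapX mmap1U.
case/andP=> R0 xn0.
have evP : map_poly (mmap (ratr_char0 F_char0) x) P = poly_of_coefs x.
  by rewrite map_poly_of_coefs; apply: eq_bigr => i _; rewrite /= mmapX mmap1U.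
split.
  apply/eqP; rewrite eqn_leq size_poly_of_coefs ltnNge; apply/negP => h.
  by move: xn0; rewrite -[x _](coef_poly_of_coefs x ord_max) nth_default ?eqxx.
have [||[u v] _ /(congr1 (map_poly (mmap (ratr_char0 F_char0) x)))] := @resultant_in_ideal _ P P^`().
- by rewrite sP ltnS ltnW.
- by rewrite sP'.
rewrite rmorphD !rmorphM /= -deriv_map evP map_polyC /= => Bez.
apply/Bezout_coprimepP; exists (map_poly (mmap (ratr_char0 F_char0) x) u,
  map_poly (mmap (ratr_char0 F_char0) x) v) => /=.
by rewrite -Bez -size_poly_eq1 size_polyC R0.
Qed.

(** The zero set of the orbit ideal is closed in moduli and contains f, through the identity matrix.
    By genericity it contains every hyperelliptic polynomial over K, so q vanishes wherever D does
    not, and q D vanishes everywhere. *)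
Lemma generic_orbit_ideal (g : nat) (k : fieldType) (f : {poly k}) (K : closedFieldType)
    (iota : {rmorphism k -> K}) (k_char0 : [pchar k] =i pred0)
    (sf : (size f <= g.+1.*2.+1)%N) (f_generic : generic g f)
    (q : {mpoly rat[g.+1.*2.+1]}) :
  orbit_ideal (map_poly iota f) q -> q = 0.
Proof.
have K_char0 : [pchar K] =i pred0 by move=> p; rewrite (fmorph_pchar iota) k_char0.
move=> fq; have [D D0 Dsep] := discriminant_exists (isT : (1 < g.+1.*2)%N).
have evE (v : 'I_(g.+1.*2.+1) -> K) r :
    (map_mpoly (ratr_char0 K_char0) r).@[v] = mmap (@ratr K) v r.
  rewrite /map_mpoly rmorph_mmap -(mmap_ratr_char0 K_char0).
  by apply: eq_mmap => [a|i] /=; rewrite ?mevalC ?mevalXU.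
have f_zeros : in_zeros (@orbit_ideal g.+1.*2 _ (map_poly iota f)) f.
  move=> p /(_ 1 0 0 1); rewrite moebius_id ?size_map_poly // => p0.
  apply: (fmorph_inj iota); rewrite rmorph0 -[RHS]p0 -(mmap_ratr_char0 k_char0) rmorph_mmap.
  apply: eq_mmap => [a|i] /=; last by rewrite coef_map.
  by rewrite fmorph_eq_rat fmorph_rat.
have qD0 : map_mpoly (ratr_char0 K_char0) (q * D) = 0.
  apply: mpoly_eq0_of_meval => v; rewrite evE -(mmap_ratr_char0 K_char0) rmorphM /= !mmap_ratr_char0.
  have [->|Dv0] := eqVneq (mmap (@ratr K) v D) 0; first by rewrite mulr0.
  have [sv sepv] := Dsep K v K_char0 Dv0.
  have hv : hyperelliptic_poly g (poly_of_coefs v) by split; [right; rewrite sv | rewrite unlock].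
  have := f_generic _ (@orbit_ideal_moduli_closed g K K_char0 (map_poly iota f)) f_zeros K _ K_char0 hv q fq.
  rewrite (_ : mmap _ _ q = mmap (@ratr K) v q) => [->|]; first by rewrite mul0r.
  by apply: eq_mmap => // i; rewrite coef_poly_of_coefs.
have : q * D = 0.
  apply/mpolyP=> m; apply: (fmorph_inj (ratr_char0 K_char0)).
  by rewrite -mcoeff_map_mpoly qD0 !mcoeff0 rmorph0.
by move/eqP; rewrite mulf_eq0 (negPf D0) orbF => /eqP.
Qed.

(** * The norm equation on a generic curve *)

Lemma coprimep_linear (E : fieldType) (a b c d : E) :
  a * d - b * c != 0 -> coprimep (a *: 'X + b%:P) (c *: 'X + d%:P).
Proof.
move=> det0; apply/Bezout_coprimepP; exists (- c%:P, a%:P) => /=.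
have -> : - c%:P * (a *: 'X + b%:P) + a%:P * (c *: 'X + d%:P) = (a * d - b * c)%:P.
  by rewrite -!mul_polyC polyCB !polyCM; ring.
by rewrite -size_poly_eq1 size_polyC det0.
Qed.

Section TransformedEquation.
Variables (K E : fieldType) (incl : {rmorphism K -> E}) (a b c d : E).
Hypothesis lin_neq0 : forall u v : K, (u != 0) || (v != 0) -> incl u * a + incl v * c != 0.
Hypothesis det_neq0 : a * d - b * c != 0.

Local Notation mob n p := (moebius n a b c d (map_poly incl p)).
Local Notation L1 := (a *: 'X + b%:P).
Local Notation L2 := (c *: 'X + d%:P).

Lemma map_moebiusM n m (p q : {poly K}) : (size p <= n.+1)%N -> (size q <= m.+1)%N ->
  mob (n + m) (p * q) = mob n p * mob m q.
Proof. by move=> sp sq; rewrite rmorphM moebiusM ?size_map_poly. Qed.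

Lemma moebius_norm_equation (g m : nat) (k : K) (A B f l : {poly K})
    (sf : (size f <= g.+1.*2.+1)%N) (sA : (size A <= m.+1)%N)
    (sB : (size B <= m - g)%N) (sl : (size l <= 2)%N)
    (norm_eq : A ^+ 2 - f * B ^+ 2 = k%:P * l ^+ m.*2) :
  mob m A ^+ 2 - mob g.+1.*2 f * mob (m - g.+1) B ^+ 2
  = (incl k)%:P * mob 1 l ^+ m.*2.
Proof.
have -> : (incl k)%:P * mob 1 l ^+ m.*2 = mob m.*2 (k%:P * l ^+ m.*2).
  rewrite !mul_polyC map_polyZ moebiusZ; congr (_ *: _).
  by rewrite rmorphXn -{2}(muln1 m.*2) moebius_exp ?size_map_poly.
rewrite -norm_eq !(rmorphB, rmorphM, rmorphXn) /=.
by rewrite (@moebius_norm _ g) ?size_map_poly.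
Qed.

(** The leading coefficient of the transform of u X + v is u a + v c, and a, c are linearly
    independent over K by [lin_neq0]. *)
Lemma size_moebius_line (l : {poly K}) :
  (size l <= 2)%N -> l != 0 -> size (mob 1 l) = 2.
Proof.
move=> sl l0; apply/eqP; rewrite eqn_leq size_moebius ltnNge; apply/negP => sm.
have lE : l = l`_1 *: 'X + (l`_0)%:P.
  rewrite [LHS](poly_monomials sl) !big_ord_recl big_ord0 /= expr0 expr1 addr0.
  by rewrite addrC alg_polyC.
have : incl l`_1 * a + incl l`_0 * c != 0.
  apply: lin_neq0; apply: contraNT l0; rewrite negb_or !negbK => /andP[/eqP l1 /eqP l00].
  by rewrite lE l1 l00 scale0r addr0.
have mlE : mob 1 l = (incl l`_1 * a + incl l`_0 * c) *: 'X
    + (incl l`_1 * b + incl l`_0 * d)%:P.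
  by rewrite {1}lE rmorphD /= map_polyZ map_polyX map_polyC /= moebius_linear.
have := nth_default 0 sm; rewrite mlE coefD coefZ coefX coefC mulr1 addr0 => ->.
by rewrite eqxx.
Qed.

(** From A = A1 (X - r) + A(r), the transform of A is A(r) L2^m modulo that of X - r. The latter is
    L1 - r L2, prime to L2 because the determinant is nonzero. *)
Lemma coprimep_moebius_affine (m : nat) (r : K) (A : {poly K}) :
  (0 < m)%N -> (size A <= m.+1)%N -> A.[r] != 0 ->
  coprimep (mob 1 ('X - r%:P)) (mob m A).
Proof.
move=> m_gt0 sA Ar.
have /factor_theorem[A1 A1E] : root (A - A.[r]%:P) r.
  by rewrite /root hornerD hornerN hornerC subrr.
have sA1 : (size A1 <= m.-1.+1)%N.
  have : (size (A1 * ('X - r%:P))%R <= m.+1)%N.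
    by rewrite -A1E (leq_trans (size_polyD _ _)) // geq_max sA size_polyN (leq_trans (size_polyC_leq1 _)).
  have [->|A10] := eqVneq A1 0; first by rewrite size_poly0.
  by rewrite size_Mmonic ?monicXsubC // size_XsubC addn2 prednK.
have -> : mob m A = mob m.-1 A1 * mob 1 ('X - r%:P) + incl A.[r] *: L2 ^+ m.
  rewrite -map_moebiusM ?size_XsubC // addn1 prednK // -A1E -(moebius1 m a b) -moebiusZ -moebiusD.
  congr (moebius _ _ _ _ _ _).
  by rewrite -[1](rmorph1 (map_poly incl)) -map_polyZ -rmorphD /= alg_polyC subrK.
rewrite coprimep_addl_mul coprimepZr ?fmorph_eq0 // coprimep_expr //.
have -> : mob 1 ('X - r%:P) = (- (incl r)%:P) * L2 + L1.
  have -> : 'X - r%:P = 1 *: 'X + (- r)%:P :> {poly K} by rewrite scale1r polyCN.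
  rewrite rmorphD /= map_polyZ map_polyX map_polyC rmorph1 raddfN moebius_linear.
  by rewrite -!mul_polyC !polyCD !polyCM !polyCN; ring.
by rewrite coprimep_sym coprimep_addl_mul coprimep_sym; exact: coprimep_linear.
Qed.

(** The case r = infinity: the constant 1, taken as a linear form, vanishes there and transforms to
    L2; the coefficient of X^m replaces A(r). *)
Lemma coprimep_moebius_infinity (m : nat) (A : {poly K}) :
  (0 < m)%N -> (size A <= m.+1)%N -> A`_m != 0 -> coprimep (mob 1 1) (mob m A).
Proof.
move=> m_gt0 sA Am; pose A1 := A - A`_m *: 'X^m.
have sA1 : (size A1 <= m.-1.+1)%N.
  rewrite prednK //; apply/leq_sizeP => j mj; rewrite coefB coefZ coefXn.
  have [->|ne] := eqVneq j m; first by rewrite mulr1 subrr.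
  by rewrite mulr0 subr0 nth_default // (leq_trans sA) // ltn_neqAle eq_sym ne.
have -> : mob m A = mob m.-1 A1 * mob 1 1 + incl A`_m *: L1 ^+ m.
  rewrite -map_moebiusM ?size_poly1 // mulr1 addn1 prednK //.
  have -> : L1 ^+ m = moebius m a b c d 'X^m by rewrite moebiusXn // subnn mulr1.
  rewrite -moebiusZ -moebiusD; congr (moebius _ _ _ _ _ _).
  by rewrite -(map_polyXn incl) -map_polyZ -rmorphD /= subrK.
rewrite coprimep_addl_mul coprimepZr ?fmorph_eq0 // coprimep_expr // rmorph1 moebius1 expr1.
by rewrite coprimep_sym; exact: coprimep_linear.
Qed.

End TransformedEquation.

Section GenericCurve.
Variables (g : nat) (k : fieldType) (f : {poly k}) (K : closedFieldType).
Variables (iota : {rmorphism k -> K}).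
Hypotheses (g_gt1 : (1 < g)%N) (k_char0 : [pchar k] =i pred0).
Hypotheses (sf : (size f <= g.+1.*2.+1)%N) (f_generic : generic g f).

Local Notation R := {mpoly K[4]}.
Local Notation E := {fraction R}.
Local Notation n := g.+1.*2.

Let incl : {rmorphism K -> E} := @tofrac R \o @mpolyC 4 K.
Let gam (i : 'I_4) : E := (@tofrac R) 'X_i.
Let F : {poly E} := moebius n (gam 0) (gam 1) (gam 2%:R) (gam 3%:R)
  (map_poly incl (map_poly iota f)).

Lemma generic_field_char0 : [pchar E] =i pred0.
Proof. by move=> p; rewrite (fmorph_pchar incl) (fmorph_pchar iota) k_char0. Qed.

(** A relation between the coefficients of F is an identity in the matrix entries. Specializing
    these to all matrices over K puts q into the orbit ideal of f. *)
Lemma generic_transform_alg_indep (q : {mpoly rat[n.+1]}) :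
  mmap (@ratr E) (fun i => F`_i) q = 0 -> q = 0.
Proof.
have K_char0 : [pchar K] =i pred0 by move=> p; rewrite (fmorph_pchar iota) k_char0.
pose Fm : {poly R} := moebius n 'X_0 'X_1 'X_(2%:R) 'X_(3%:R)
  (map_poly (@mpolyC 4 K) (map_poly iota f)).
have FE : F = map_poly (@tofrac R) Fm.
  by rewrite /Fm map_moebius /= -map_poly_comp.
move=> q0; apply: (generic_orbit_ideal (iota := iota) k_char0 sf f_generic) => a b c d.
have {}q0 : mmap (@mpolyC 4 K \o ratr_char0 K_char0) (fun i => Fm`_i) q = 0.
  apply/eqP; rewrite -tofrac_eq0 rmorph_mmap -[X in _ == X]q0; apply/eqP.
  apply: eq_mmap => [r|i] /=; last by rewrite FE coef_map.
  by rewrite fmorph_eq_rat -(fmorph_rat incl).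
pose v (i : 'I_4) := nth 0 [:: a; b; c; d] i.
have := congr1 (meval v) q0; rewrite meval0 rmorph_mmap => h; rewrite -[RHS]h.
apply: eq_mmap => [r|i] /=; first by rewrite mevalC fmorph_eq_rat.
rewrite -coef_map map_moebius /= !mevalXU -map_poly_comp.
have -> : map_poly (meval v \o @mpolyC 4 K) (map_poly iota f) = map_poly iota f.
  by apply/polyP => l; rewrite [LHS]coef_map /= mevalC.
by [].
Qed.

(** Independence keeps F off the zero set of D; in particular F has degree 2g+2 even when f has
    degree 2g+1. *)
Lemma generic_transform_separable : size F = n.+1 /\ coprimep F F^`().
Proof.
have [D D0 Dsep] := discriminant_exists (isT : (1 < n)%N).
have := Dsep E (fun i => F`_i) generic_field_char0.
rewrite poly_of_coefsK ?size_moebius //; apply; apply: contra_neq D0.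
exact: generic_transform_alg_indep.
Qed.

Lemma linear_coef_neq0 (u v : K) : (u != 0) || (v != 0) ->
  incl u * gam 0 + incl v * gam 2%:R != 0.
Proof.
have -> : incl u * gam 0 + incl v * gam 2%:R
    = @tofrac R (u%:MP * 'X_0 + v%:MP * 'X_(2%:R)) by rewrite rmorphD !rmorphM.
rewrite tofrac_eq0; apply: contraTneq => e.
have := congr1 (mcoeff U_(0)) e; have := congr1 (mcoeff U_(2%:R)) e.
rewrite !mcoeffD !mcoeffCM !mcoeffX !eq_mnm1 !mcoeff0 /= !mulr0 !mulr1 add0r addr0 => -> ->.
by rewrite eqxx.
Qed.

Lemma generic_det_neq0 : gam 0 * gam 3%:R - gam 1 * gam 2%:R != 0.
Proof.
rewrite /gam -!rmorphM -rmorphB tofrac_eq0; apply/eqP => e.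
pose v (i : 'I_4) : K := nth 0 [:: 1; 0; 0; 1] i.
have := congr1 (meval v) e; rewrite mevalB !mevalM !mevalXU meval0 /v /= mulr1 mulr0 subr0.
by apply/eqP; exact: oner_neq0.
Qed.

Lemma no_generic_torsion_equation (m : nat) (c : K) (A B l : {poly K})
    (m_gt0 : (0 < m)%N) (c0 : c != 0)
    (sA : (size A <= m.+1)%N) (sB : (size B <= m - g)%N)
    (norm_eq : A ^+ 2 - map_poly iota f * B ^+ 2 = c%:P * l ^+ m.*2)
    (l_root : (exists2 a, l = 'X - a%:P & A.[a] != 0) \/ (l = 1 /\ A`_m != 0)) :
  False.
Proof.
have sl : (size l <= 2)%N.
  by case: l_root => [[a -> _]|[-> _]]; rewrite ?size_XsubC ?size_poly1.
have l0 : l != 0.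
  by case: l_root => [[a -> _]|[-> _]]; rewrite ?polyXsubC_eq0 ?oner_eq0.
have [sF sepF] := generic_transform_separable.
have sf' : (size (map_poly iota f) <= n.+1)%N by rewrite size_map_poly.
have tr_eq := moebius_norm_equation incl (gam 0) (gam 1) (gam 2%:R) (gam 3%:R)
  sf' sA sB sl norm_eq.
have sml := size_moebius_line (incl := incl) (gam 1) (gam 3%:R) linear_coef_neq0 sl l0.
apply: (no_torsion_equation generic_field_char0 g_gt1 m_gt0 _ sepF _ _ sml _ _ tr_eq).
- by rewrite sF; clear; lia.
- exact: size_moebius.
- have [->|B0] := eqVneq B 0.
    by rewrite rmorph0 moebius0 size_poly0.
  have mg : (g < m)%N.
    rewrite ltnNge; apply: contra B0 => le; rewrite -size_poly_leq0 (leq_trans sB) //.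
    by rewrite leq_subLR addn0.
  by rewrite -(subnSK mg) size_moebius.
- case: l_root => [[a -> Aa]|[-> Am]].
    exact: (coprimep_moebius_affine incl generic_det_neq0 m_gt0 sA Aa).
  exact: (coprimep_moebius_infinity incl generic_det_neq0 m_gt0 sA Am).
- by rewrite fmorph_eq0.
move=> v sv.
(* The coefficients of F are independent, so their derivatives may be prescribed to be those of
   v. *)
have [d [dB dM dv]] := derivation_of_alg_indep (fun i : 'I_n.+1 => v`_i)
  generic_field_char0 generic_transform_alg_indep.
exists d; split=> //; apply/polyP => i; rewrite (coef_derivation dB).
have [i_lt|i_ge] := ltnP i n.+1; first exact: (dv (Ordinal i_lt)).
rewrite !nth_default ?(derivation0 dB) ?sF //.
by apply: leq_trans sv _; apply: leq_trans i_ge; clear; lia.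
Qed.

End GenericCurve.

(** * Local rings of a plane chart *)

Section Eval2.
Variables (R : comNzRingType) (x y : R).

Lemma eval2M p q : eval2 (p * q) x y = eval2 p x y * eval2 q x y.
Proof. by rewrite /eval2 !hornerM. Qed.

Lemma eval2D p q : eval2 (p + q) x y = eval2 p x y + eval2 q x y.
Proof. by rewrite /eval2 !hornerD. Qed.

Lemma eval2N p : eval2 (- p) x y = - eval2 p x y.
Proof. by rewrite /eval2 !hornerN. Qed.

Lemma eval2C p : eval2 p%:P x y = p.[x].
Proof. by rewrite /eval2 hornerC. Qed.

Lemma eval2X : eval2 'X x y = y.
Proof. by rewrite /eval2 hornerX hornerC. Qed.

End Eval2.

Section Chart.
Variables (K L : fieldType) (j : {rmorphism K -> L}) (F : {poly K}) (z : L * L).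
Hypothesis z_eq : z.2 ^+ 2 = (map_poly j F).[z.1].
Hypothesis z_free : forall p0 p1 : {poly K},
  (map_poly j p0).[z.1] + (map_poly j p1).[z.1] * z.2 = 0 -> p0 = 0 /\ p1 = 0.

Local Notation ev p := ((map_poly j p).[z.1]).

Lemma eval2_inM p q : eval2_in j (p * q) z = eval2_in j p z * eval2_in j q z.
Proof. by rewrite /eval2_in rmorphM eval2M. Qed.

Lemma eval2_inD p q : eval2_in j (p + q) z = eval2_in j p z + eval2_in j q z.
Proof. by rewrite /eval2_in rmorphD eval2D. Qed.

Lemma eval2_inN p : eval2_in j (- p) z = - eval2_in j p z.
Proof. by rewrite /eval2_in rmorphN eval2N. Qed.

Lemma eval2_inC p : eval2_in j p%:P z = ev p.
Proof. by rewrite /eval2_in map_polyC eval2C. Qed.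

Lemma eval2_inX : eval2_in j 'X z = z.2.
Proof. by rewrite /eval2_in map_polyX eval2X. Qed.

(** The equation of the curve lowers powers of the second coordinate. The same p0 and p1 serve in
    the function field and at all points, so that a polynomial which is zero in L has value zero at
    each point. *)
Lemma eval2_reduce (p : {poly {poly K}}) : exists p0 p1 : {poly K},
  eval2_in j p z = ev p0 + ev p1 * z.2
  /\ forall a b, b ^+ 2 = F.[a] -> eval2 p a b = p0.[a] + p1.[a] * b.
Proof.
elim/poly_ind: p => [|p c [p0 [p1 [pE pab]]]].
  exists 0, 0; split=> [|a b _]; first by rewrite /eval2_in /eval2 !rmorph0 !horner0 mul0r addr0.
  by rewrite /eval2 !horner0 mul0r addr0.
exists (c + p1 * F), p0; split=> [|a b ab].
  rewrite eval2_inD eval2_inM eval2_inC eval2_inX pE !rmorphD !rmorphM /= !hornerD !hornerM -z_eq.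
  by ring.
by rewrite eval2D eval2M eval2C eval2X (pab _ _ ab) !hornerD !hornerM -ab; ring.
Qed.

(** * The local ring at a point of the chart *)

Section Point.
Variable c : K * K.
Hypothesis c_eq : c.2 ^+ 2 = F.[c.1].

Definition chart_local (h : L) := exists p q : {poly {poly K}},
  eval2 q c.1 c.2 != 0 /\ h = eval2_in j p z / eval2_in j q z.

Definition chart_maximal (h : L) := exists p q : {poly {poly K}},
  [/\ eval2 q c.1 c.2 != 0, eval2 p c.1 c.2 = 0 & h = eval2_in j p z / eval2_in j q z].

Definition chart_uniformizer (t : L) := chart_maximal t /\
  forall h, chart_maximal h -> exists2 u, chart_local u & h = u * t.

Definition chart_unit (h : L) := exists p q : {poly {poly K}},
  [/\ eval2 p c.1 c.2 != 0, eval2 q c.1 c.2 != 0 & h = eval2_in j p z / eval2_in j q z].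

Lemma eval2_in_eq0 p : eval2_in j p z = 0 -> eval2 p c.1 c.2 = 0.
Proof.
have [p0 [p1 [-> ->]]] // := eval2_reduce p.
by move=> /z_free[-> ->]; rewrite !horner0 mul0r addr0.
Qed.

Lemma eval2_in_neq0 p : eval2 p c.1 c.2 != 0 -> eval2_in j p z != 0.
Proof. by apply: contra_neq; exact: eval2_in_eq0. Qed.

Lemma chart_unit_neq0 h : chart_unit h -> h != 0.
Proof.
by move=> [p [q [pc qc ->]]]; rewrite mulf_neq0 ?invr_eq0 ?eval2_in_neq0.
Qed.

Lemma chart_unitV h : chart_unit h -> chart_unit h^-1.
Proof. by move=> [p [q [pc qc ->]]]; exists q, p; split; rewrite // invf_div. Qed.

Lemma chart_unitM h h' : chart_unit h -> chart_unit h' -> chart_unit (h * h').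
Proof.
move=> [p [q [pc qc ->]]] [p' [q' [pc' qc' ->]]]; exists (p * p'), (q * q').
by rewrite !eval2M !mulf_neq0 // !eval2_inM mulf_div.
Qed.

Lemma chart_unit_eval p : eval2 p c.1 c.2 != 0 -> chart_unit (eval2_in j p z).
Proof.
move=> pc; exists p, 1%:P; split=> //; rewrite ?eval2C ?hornerC ?oner_neq0 //.
by rewrite eval2_inC rmorph1 hornerC divr1.
Qed.

Lemma chart_unit1 : chart_unit 1.
Proof.
have -> : 1 = eval2_in j 1%:P z by rewrite eval2_inC rmorph1 hornerC.
by apply: chart_unit_eval; rewrite eval2C hornerC oner_neq0.
Qed.

Lemma chart_unitX h n : chart_unit h -> chart_unit (h ^+ n).
Proof.
move=> hu; elim: n => [|n IH]; first by rewrite expr0; exact: chart_unit1.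
by rewrite exprS; exact: chart_unitM.
Qed.

Lemma chart_unit_local h : chart_unit h -> chart_local h.
Proof. by move=> [p [q [pc qc ->]]]; exists p, q. Qed.

Lemma chart_localM h h' : chart_local h -> chart_local h' -> chart_local (h * h').
Proof.
move=> [p [q [qc ->]]] [p' [q' [qc' ->]]]; exists (p * p'), (q * q').
by rewrite !eval2M !mulf_neq0 // !eval2_inM mulf_div.
Qed.

Lemma chart_localX h n : chart_local h -> chart_local (h ^+ n).
Proof.
move=> hu; elim: n => [|n IH]; first by rewrite expr0; exact/chart_unit_local/chart_unit1.
by rewrite exprS; exact: chart_localM.
Qed.

(** With h = p/q and 1/h = p'/q', the relation p p' = q q' holds in L, hence at the point, where q
    q' does not vanish; so neither does p. *)
Lemma chart_unitP h : h != 0 -> chart_local h -> chart_local h^-1 -> chart_unit h.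
Proof.
move=> h0 [p [q [qc hE]]] [p' [q' [qc' hE']]]; exists p, q; split=> //.
have : eval2 (p * p' - q * q') c.1 c.2 = 0.
  apply: eval2_in_eq0; rewrite eval2_inD eval2_inN !eval2_inM.
  have q0 := eval2_in_neq0 qc; have q0' := eval2_in_neq0 qc'.
  have : h * h^-1 = 1 by rewrite divff.
  rewrite hE' hE mulf_div => /(congr1 ( *%R^~ (eval2_in j q z * eval2_in j q' z))).
  by rewrite divfK ?mulf_neq0 // mul1r => ->; rewrite subrr.
rewrite eval2D eval2N !eval2M => /eqP; rewrite subr_eq0 => /eqP e.
apply: contraTneq qc' => p0; rewrite negbK; move/eqP: e.
by rewrite p0 mul0r eq_sym mulf_eq0 (negPf qc).
Qed.

Lemma chart_maximal_local h : chart_maximal h -> chart_local h.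
Proof. by move=> [p [q [qc _ ->]]]; exists p, q. Qed.

Lemma chart_maximal_eval p : eval2 p c.1 c.2 = 0 -> chart_maximal (eval2_in j p z).
Proof.
move=> pc; exists p, 1%:P; split=> //; rewrite ?eval2C ?hornerC ?oner_neq0 //.
by rewrite eval2_inC rmorph1 hornerC divr1.
Qed.

Lemma chart_maximal_nonunit p :
  eval2 p c.1 c.2 = 0 -> ~ chart_unit (eval2_in j p z).
Proof.
move=> p0 [r [q [rc qc e]]]; have q0 := eval2_in_neq0 qc.
have : eval2 (p * q - r) c.1 c.2 = 0.
  by apply: eval2_in_eq0; rewrite eval2_inD eval2_inN eval2_inM e divfK ?subrr.
rewrite eval2D eval2N eval2M p0 mul0r sub0r => /eqP; rewrite oppr_eq0.
exact/negP.
Qed.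

Local Notation sX := ('X - c.1%:P).

Lemma ev_Xsub : ev sX = z.1 - j c.1.
Proof. by rewrite map_polyXsubC hornerXsubC. Qed.

Lemma ev_Xsub_neq0 : z.1 - j c.1 != 0.
Proof.
apply/eqP=> e; have := @z_free sX 0; rewrite ev_Xsub e rmorph0 horner0 mul0r addr0.
by move=> /(_ erefl)[/eqP]; rewrite polyXsubC_eq0.
Qed.

Lemma factor_at (p : {poly K}) : p.[c.1] = 0 -> exists q, p = q * sX.
Proof. by move/rootP/factor_theorem. Qed.

Lemma uniformizer_of_divides (t : L) : chart_maximal t ->
  (forall p0 p1 : {poly K}, p0.[c.1] + p1.[c.1] * c.2 = 0 ->
     exists2 u, chart_local u & ev p0 + ev p1 * z.2 = u * t) ->
  chart_uniformizer t.
Proof.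
move=> tm div; split=> // h [p [q [qc pc ->]]].
have [p0 [p1 [pE pcE]]] := eval2_reduce p.
have [|u ul uE] := div p0 p1; first by rewrite -pcE.
exists (u / eval2_in j q z); last by rewrite pE uE mulrAC.
by apply: chart_localM ul _; apply/chart_unit_local/chart_unitV/chart_unit_eval.
Qed.

Lemma chart_localD_ev (p0 p1 : {poly K}) : chart_local (ev p0 + ev p1 * z.2).
Proof.
exists (p0%:P + p1%:P * 'X), 1%:P; rewrite eval2C hornerC oner_neq0.
by rewrite eval2_inD eval2_inM !eval2_inC eval2_inX rmorph1 hornerC divr1.
Qed.

(** At (a, b), write p0 + p1 y = (p0 + b p1) + p1 (y - b). The first summand is divisible by x - a,
    and so is (y - b)(y + b) = F(x) - F(a), where y + b is a unit because its value 2b is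
    nonzero. *)
Lemma uniformizer_unramified : c.2 *+ 2 != 0 -> chart_uniformizer (z.1 - j c.1).
Proof.
move=> c2; apply: uniformizer_of_divides.
  by rewrite -ev_Xsub -eval2_inC; apply: chart_maximal_eval; rewrite eval2C hornerXsubC subrr.
move=> p0 p1 pc.
have [s sE] : exists s, p0 + c.2 *: p1 = s * sX.
  by apply: factor_at; rewrite hornerD hornerZ -pc mulrC.
have [r rE] : exists r, F - (c.2 ^+ 2)%:P = r * sX.
  by apply: factor_at; rewrite hornerD hornerN hornerC c_eq subrr.
have w_unit : chart_unit (z.2 + j c.2).
  have -> : z.2 + j c.2 = eval2_in j ('X + c.2%:P%:P) z.
    by rewrite eval2_inD eval2_inX eval2_inC map_polyC hornerC.
  by apply: chart_unit_eval; rewrite eval2D eval2X eval2C hornerC -mulr2n.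
have w0 := chart_unit_neq0 w_unit.
exists ((ev p1 * ev r + ev s * (z.2 + j c.2)) / (z.2 + j c.2)).
  apply: chart_localM; last exact/chart_unit_local/chart_unitV.
  have -> : ev p1 * ev r + ev s * (z.2 + j c.2) = ev (p1 * r + c.2 *: s) + ev s * z.2.
    by rewrite rmorphD rmorphM /= map_polyZ hornerD hornerM hornerZ; ring.
  exact: chart_localD_ev.
have p0E : ev p0 = ev s * (z.1 - j c.1) - j c.2 * ev p1.
  rewrite -ev_Xsub -hornerM -rmorphM -sE rmorphD /= map_polyZ hornerD hornerZ; ring.
have FE : z.2 ^+ 2 = ev r * (z.1 - j c.1) + j c.2 ^+ 2.
  rewrite z_eq -ev_Xsub -hornerM -rmorphM -rE rmorphB /= map_polyC hornerD hornerN hornerC.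
  by rewrite /= rmorphXn subrK.
apply: (mulIf w0); rewrite mulrAC divfK // p0E.
have -> : (ev s * (z.1 - j c.1) - j c.2 * ev p1 + ev p1 * z.2) * (z.2 + j c.2)
   = ev s * (z.1 - j c.1) * (z.2 + j c.2) + ev p1 * (z.2 ^+ 2 - j c.2 ^+ 2) by ring.
rewrite FE; ring.
Qed.

Section Ramified.
Variable F1 : {poly K}.
Hypotheses (c2_0 : c.2 = 0) (F_E : F = F1 * sX) (F1c : F1.[c.1] != 0).

Lemma ramified_sqr : exists2 u, chart_unit u & z.1 - j c.1 = u * z.2 ^+ 2.
Proof.
have F1u : chart_unit (ev F1).
  by rewrite -eval2_inC; apply: chart_unit_eval; rewrite eval2C.
exists (ev F1)^-1; first exact: chart_unitV.
by rewrite z_eq F_E rmorphM hornerM ev_Xsub mulKf // chart_unit_neq0.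
Qed.

(** x - a is a unit times y^2, so p0 + p1 y is divisible by y as soon as p0(a) = 0. *)
Lemma uniformizer_ramified : chart_uniformizer z.2.
Proof.
apply: uniformizer_of_divides.
  by rewrite -eval2_inX; apply: chart_maximal_eval; rewrite eval2X.
move=> p0 p1; rewrite c2_0 mulr0 addr0 => /factor_at[s ->].
have [u uu uE] := ramified_sqr.
exists (ev s * u * z.2 + ev p1); last first.
  rewrite rmorphM hornerM ev_Xsub uE; ring.
have [p [q [pc qc ->]]] := uu.
exists (s%:P * p * 'X + p1%:P * q), q; split=> //; have q0 := eval2_in_neq0 qc.
rewrite eval2_inD !eval2_inM !eval2_inC eval2_inX.
by field.
Qed.

End Ramified.

Lemma uniformizer_neq0 t : chart_uniformizer t -> t != 0.
Proof.
move=> [_ tu]; have [|u _ e] := tu (z.1 - j c.1).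
  by rewrite -ev_Xsub -eval2_inC; apply: chart_maximal_eval; rewrite eval2C hornerXsubC subrr.
by apply: contraNneq ev_Xsub_neq0 => t0; rewrite e t0 mulr0.
Qed.

Lemma uniformizer_unique t t' : chart_uniformizer t -> chart_uniformizer t' ->
  exists2 u, chart_unit u & t = u * t'.
Proof.
move=> tu tu'; have [u ul uE] := tu'.2 t tu.1; have [u' ul' uE'] := tu.2 t' tu'.1.
have t0 := uniformizer_neq0 tu.
have uu' : u * u' = 1 by apply: (mulIf t0); rewrite mul1r -mulrA -uE'.
have u0 : u != 0 by apply: contra_eq_neq uu' => ->; rewrite mul0r eq_sym oner_neq0.
exists u => //; apply: chart_unitP => //.
by rewrite -[u^-1]mulr1 -uu' mulKf.
Qed.

End Point.

(** A denominator Q that vanishes at neither conjugate point is multiplied by its conjugate. This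
    gives Q0^2 - Q1^2 F in x alone, whose value at a is the product of the two values of Q. *)
Lemma common_denominator (h : L) (a b : K) : b ^+ 2 = F.[a] ->
  chart_local (a, b) h -> chart_local (a, - b) h ->
  exists D A B : {poly K}, D.[a] != 0 /\ ev D * h = ev A + ev B * z.2.
Proof.
move=> ab [p [q [/= qc hE]]] [p' [q' [/= qc' hE']]].
have abN : (- b) ^+ 2 = F.[a] by rewrite sqrrN.
have q0 : eval2_in j q z != 0 by apply: (@eval2_in_neq0 (a, b)).
have q0' : eval2_in j q' z != 0 by apply: (@eval2_in_neq0 (a, - b)).
have [P [Q [Qb QNb hQ]]] : exists P Q : {poly {poly K}},
    [/\ eval2 Q a b != 0, eval2 Q a (- b) != 0 & eval2_in j Q z * h = eval2_in j P z].
  have [qN|qN] := eqVneq (eval2 q a (- b)) 0; last first.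
    by exists p, q; split=> //; rewrite hE mulrC divfK.
  have [qN'|qN'] := eqVneq (eval2 q' a b) 0; last first.
    by exists p', q'; split=> //; rewrite hE' mulrC divfK.
  (* Each of q and q' vanishes at exactly one of the two points, and not at the same one, so the sum
     vanishes at neither. *)
  exists (p + p'), (q + q'); rewrite !eval2D qN qN' addr0 add0r; split=> //.
  by rewrite !eval2_inD mulrDl {1}hE mulrC divfK // hE' [X in _ + X]mulrC divfK.
have [Q0 [Q1 [QE Qab]]] := eval2_reduce Q; have [P0 [P1 [PE _]]] := eval2_reduce P.
exists (Q0 ^+ 2 - Q1 ^+ 2 * F), (P0 * Q0 - P1 * Q1 * F), (P1 * Q0 - P0 * Q1); split.
  have -> : (Q0 ^+ 2 - Q1 ^+ 2 * F).[a] = eval2 Q a b * eval2 Q a (- b).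
    by rewrite !Qab // !(hornerD, hornerN, hornerM, horner_exp) -ab; ring.
  by rewrite mulf_neq0.
rewrite !(rmorphB, rmorphM, rmorphXn) !(hornerD, hornerN, hornerM, horner_exp).
have hQ' : (ev Q0 + ev Q1 * z.2) * h = ev P0 + ev P1 * z.2 by rewrite -QE -PE.
rewrite -z_eq; have -> : (ev Q0 ^+ 2 - ev Q1 ^+ 2 * z.2 ^+ 2) * h
   = (ev Q0 - ev Q1 * z.2) * ((ev Q0 + ev Q1 * z.2) * h) by ring.
rewrite hQ'; ring.
Qed.

End Chart.

(** * The two charts of a hyperelliptic curve *)

Section Reciprocal.
Variable R : comNzRingType.

(** This is X^N p(1/X), written as the action of the matrix exchanging 0 and infinity so that the
    results on [moebius] apply. *)
Definition reciprocal (N : nat) (p : {poly R}) : {poly R} := moebius N 0 1 1 0 p.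

Lemma reciprocalE N (p : {poly R}) : reciprocal N p = \sum_(i < N.+1) p`_i *: 'X^(N - i).
Proof.
by apply: eq_bigr => i _; rewrite scale0r add0r scale1r addr0 expr1n mul1r.
Qed.

Lemma coef_reciprocal N (p : {poly R}) i : (i <= N)%N -> (reciprocal N p)`_i = p`_(N - i).
Proof.
move=> iN; rewrite reciprocalE coef_sum.
have lt_i : (N - i < N.+1)%N by rewrite ltnS leq_subr.
rewrite (bigD1 (Ordinal lt_i)) //= coefZ coefXn subKn // eqxx mulr1 big1 ?addr0 // => k ki.
rewrite coefZ coefXn; case: eqP => [e|]; last by rewrite mulr0.
by case/eqP: ki; apply: val_inj; rewrite /= e subKn // -ltnS.
Qed.

Lemma reciprocalK N (p : {poly R}) : (size p <= N.+1)%N -> reciprocal N (reciprocal N p) = p.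
Proof.
by move=> sp; rewrite /reciprocal moebius_comp !(mul0r, mulr0, mul1r, add0r, addr0) moebius_id.
Qed.

Lemma reciprocal_eq0 N (p : {poly R}) : (size p <= N.+1)%N -> reciprocal N p = 0 -> p = 0.
Proof. by move=> sp e; rewrite -(reciprocalK sp) e /reciprocal moebius0. Qed.

Lemma size_reciprocal N (p : {poly R}) : (size (reciprocal N p) <= N.+1)%N.
Proof. exact: size_moebius. Qed.

Lemma horner0_reciprocal N (p : {poly R}) : (reciprocal N p).[0] = p`_N.
Proof. by rewrite horner_coef0 coef_reciprocal // subn0. Qed.

End Reciprocal.

Lemma map_reciprocal (R S : comNzRingType) (s : {rmorphism R -> S}) N (p : {poly R}) :
  map_poly s (reciprocal N p) = reciprocal N (map_poly s p).
Proof. by rewrite /reciprocal map_moebius rmorph0 rmorph1. Qed.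

Lemma horner_reciprocal (F : fieldType) N (p : {poly F}) (t : F) :
  (size p <= N.+1)%N -> t != 0 -> (reciprocal N p).[t^-1] * t ^+ N = p.[t].
Proof.
move=> sp t0; rewrite reciprocalE horner_sum mulr_suml (horner_coef_wide _ sp).
apply: eq_bigr => i _; rewrite hornerZ hornerXn -mulrA; congr (_ * _).
have iN : (i <= N)%N by rewrite -ltnS.
have -> : t ^+ N = t ^+ (N - i) * t ^+ i by rewrite -exprD subnK.
by rewrite mulrA -exprMn mulVf // expr1n mul1r.
Qed.

Section HyperellipticCurve.
Variables (g : nat) (K : closedFieldType) (L : fieldType) (j : {rmorphism K -> L}).
Variables (f : {poly K}) (x y : L).
Hypotheses (K_char0 : [pchar K] =i pred0) (f_hyp : hyperelliptic_poly g f).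
Hypothesis L_ff : is_function_field j f x y.
Local Notation n := g.+1.*2.

Lemma size_hyperelliptic_poly : (size f <= n.+1)%N.
Proof. by case: f_hyp => [[/eqP->|/eqP->]]. Qed.

Lemma ev_eq0 (p : {poly K}) : (map_poly j p).[x] = 0 -> p = 0.
Proof.
move=> px; apply/eqP; apply: contraPT (ff_transcendental L_ff) => p0.
by case; exists p => //; exact/rootP.
Qed.

Lemma x_neq0 : x != 0.
Proof.
apply/eqP=> x0; have := @ev_eq0 'X; rewrite map_polyX hornerX => /(_ x0)/eqP.
by rewrite polyX_eq0.
Qed.

(* Infinite descent at a simple root of f. *)
Lemma hyperelliptic_not_square (p q : {poly K}) : p ^+ 2 = q ^+ 2 * f -> q = 0.
Proof.
have [sf sepf] := f_hyp.
have /closed_rootP[a fa] : size f != 1%N by case: sf => /eqP ->.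
have [f1 f1E] := factor_theorem _ _ fa.
have f1a : f1.[a] != 0.
  move: sepf; rewrite unlock => /coprimep_root/(_ fa); apply: contraNneq => f1a.
  by rewrite f1E derivM derivXsubC hornerD !hornerM hornerXsubC hornerC f1a subrr mulr0 mul0r addr0.
have [s] := ubnP (size q); elim: s p q => // s IH p q sq pq.
have pa : root p a.
  have : root (p ^+ 2) a by rewrite pq rootM fa orbT.
  by rewrite expr2 rootM orbb.
have [p1 p1E] := factor_theorem _ _ pa.
have Xa0 : 'X - a%:P != 0 by rewrite polyXsubC_eq0.
have pq1 : p1 ^+ 2 * ('X - a%:P) = q ^+ 2 * f1.
  by apply: (mulIf Xa0); rewrite -mulrA -expr2 -exprMn -p1E pq f1E mulrA.
have qa : root q a.
  have : root (q ^+ 2 * f1) a by rewrite -pq1 rootM root_XsubC eqxx orbT.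
  by rewrite rootM expr2 rootM orbb /root (negPf f1a) orbF.
have [q1 q1E] := factor_theorem _ _ qa.
have [q10|q10] := eqVneq q1 0; first by rewrite q1E q10 mul0r.
suff : q1 = 0 by move=> q1_0; rewrite q1_0 eqxx in q10.
apply: (IH p1); last first.
  by apply: (mulIf Xa0); rewrite pq1 q1E f1E exprMn expr2 [in LHS]expr2; ring.
by rewrite (leq_trans _ (sq : (size q <= s)%N)) // q1E size_Mmonic ?monicXsubC // size_XsubC addn2.
Qed.

(** Otherwise y would be a rational function of x, and f a square in K(x). *)
Lemma affine_free (p0 p1 : {poly K}) :
  (map_poly j p0).[x] + (map_poly j p1).[x] * y = 0 -> p0 = 0 /\ p1 = 0.
Proof.
move=> e; have p1_0 : p1 = 0.
  apply: (@hyperelliptic_not_square p0); apply/eqP; rewrite -subr_eq0; apply/eqP/ev_eq0.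
  rewrite !(rmorphB, rmorphM, rmorphXn) /= !(hornerD, hornerN, hornerM, horner_exp).
  rewrite -(ff_equation L_ff).
  have -> : (map_poly j p0).[x] = - ((map_poly j p1).[x] * y).
    by apply/eqP; rewrite -addr_eq0 e.
  by ring.
by split=> //; apply: ev_eq0; move: e; rewrite p1_0 rmorph0 horner0 mul0r addr0.
Qed.

Local Notation u := (x^-1).
Local Notation v := (y / x ^+ g.+1).

Lemma ev_reciprocal N (p : {poly K}) : (size p <= N.+1)%N ->
  (map_poly j p).[u] * x ^+ N = (map_poly j (reciprocal N p)).[x].
Proof.
move=> sp; rewrite -{1}(reciprocalK sp) map_reciprocal horner_reciprocal ?x_neq0 //.
by rewrite size_map_poly size_reciprocal.
Qed.

Lemma infinity_eq : v ^+ 2 = (map_poly j (reciprocal n f)).[u].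
Proof.
have xn0 : x ^+ n != 0 by rewrite expf_neq0 ?x_neq0.
apply: (mulIf xn0); rewrite ev_reciprocal ?size_reciprocal // reciprocalK ?size_hyperelliptic_poly //.
rewrite -(ff_equation L_ff) expr_div_n -exprM muln2 divfK //.
Qed.

(** Clearing denominators by a power of x turns the relation into one between 1 and y over K[x]. *)
Lemma infinity_free (p0 p1 : {poly K}) :
  (map_poly j p0).[u] + (map_poly j p1).[u] * v = 0 -> p0 = 0 /\ p1 = 0.
Proof.
move=> e; pose N := maxn (size p0) (size p1).
have s0 : (size p0 <= N.+1)%N by rewrite leqW // leq_maxl.
have s1 : (size p1 <= N.+1)%N by rewrite leqW // leq_maxr.
have xg0 : x ^+ g.+1 != 0 by rewrite expf_neq0 ?x_neq0.
have [|/eqP r0 /(reciprocal_eq0 s1) ->] :=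
  @affine_free (reciprocal N p0 * 'X^(g.+1)) (reciprocal N p1).
  rewrite rmorphM /= map_polyXn hornerM hornerXn -!ev_reciprocal //.
  rewrite -[RHS](mul0r (x ^+ N * x ^+ g.+1)) -[in RHS]e.
  by move: xg0; move: (x ^+ g.+1) => X X0; field.
split=> //; apply: (reciprocal_eq0 s0); apply/eqP; move: r0.
by rewrite mulf_eq0 (negPf (monic_neq0 (monicXn _ _))) orbF.
Qed.

Local Notation point_on := (curve g f).

Definition chart_poly (P : point_on) : {poly K} :=
  match val P with Aff _ _ => f | Infty _ => reciprocal n f end.

Lemma chart_eq P : (chart x y P).2 ^+ 2 = (map_poly j (chart_poly P)).[(chart x y P).1].
Proof.
rewrite /chart /chart_poly; case: (val P) => [a b|s] /=; last exact: infinity_eq.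
exact: ff_equation L_ff.
Qed.

Lemma chart_free (P : point_on) (p0 p1 : {poly K}) :
  (map_poly j p0).[(chart x y P).1] + (map_poly j p1).[(chart x y P).1] * (chart x y P).2 = 0 ->
  p0 = 0 /\ p1 = 0.
Proof.
rewrite /chart; case: (val P) => [a b|s] /=; last exact: infinity_free.
exact: affine_free.
Qed.

Lemma center_eq (P : point_on) : (center P).2 ^+ 2 = (chart_poly P).[(center P).1].
Proof.
have := valP P; rewrite /center /chart_poly; case: (val P) => [a b|s] /= /eqP -> //.
by rewrite horner0_reciprocal.
Qed.

Lemma weierstrassP (P : point_on) : weierstrass P <-> (center P).2 = 0.
Proof.
have two0 : 2%:R != 0 :> K by rewrite ((pcharf0P K).1 K_char0).
have NK (a : K) : - a = a -> a = 0.
  move=> e; apply/eqP; rewrite -(mulrI_eq0 _ (lregP two0)).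
  by rewrite mulr_natl mulr2n -{1}e addNr.
rewrite /weierstrass /center; case: (val P) => [a b|s] /=; split.
- by case=> /NK.
- by move=> ->; rewrite oppr0.
- by case=> /NK.
- by move=> ->; rewrite oppr0.
Qed.

Lemma weierstrass_simple_root (P : point_on) : weierstrass P ->
  exists2 F1, chart_poly P = F1 * ('X - (center P).1%:P) & F1.[(center P).1] != 0.
Proof.
move=> /weierstrassP c2; have := center_eq P; rewrite c2 expr0n /= => /esym/rootP r.
have [F1 F1E] := factor_theorem _ _ r; exists F1 => //; apply/eqP => F1c.
have : root (chart_poly P)^`() (center P).1.
  by rewrite F1E derivM derivXsubC /root hornerD !hornerM hornerXsubC hornerC F1c subrr mulr0 mul0r addr0.
move: r; rewrite /chart_poly /center; case: (val P) => [a b|s] /= r r'.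
  by have [_] := f_hyp; rewrite unlock => /coprimep_root/(_ r); rewrite (rootP r') eqxx.
(* At infinity, a double root of the reciprocal polynomial at 0 would kill the coefficients of f in
   degrees 2g+2 and 2g+1, one of which is the leading one. *)
move: r r'; rewrite /root horner0_reciprocal horner_coef0 coef_deriv coef_reciprocal //.
move=> /eqP fn /eqP; rewrite mulr1n subn1 => fn1.
have [[/eqP sf|/eqP sf] _] := f_hyp.
  have : lead_coef f != 0 by rewrite lead_coef_eq0 -size_poly_gt0 sf.
  by rewrite lead_coefE sf fn1 eqxx.
have : lead_coef f != 0 by rewrite lead_coef_eq0 -size_poly_gt0 sf.
by rewrite lead_coefE sf fn eqxx.
Qed.

Local Notation local_unit R h := (chart_unit j (chart x y R) (center R) h).

Lemma uniformizer_exists (R : point_on) : exists t, uniformizer j x y R t.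
Proof.
have [c2|c2] := eqVneq (center R).2 0.
  have [F1 F1E F1c] := weierstrass_simple_root ((weierstrassP R).2 c2).
  exists (chart x y R).2.
  exact: (uniformizer_ramified (chart_eq R) (@chart_free R) (center_eq R) c2 F1E F1c).
exists ((chart x y R).1 - j (center R).1).
apply: (uniformizer_unramified (chart_eq R) (@chart_free R) (center_eq R)).
by rewrite -mulr_natl mulf_neq0 // ((pcharf0P K).1 K_char0).
Qed.

Lemma has_orderP (R : point_on) h (d : int) : has_order j x y R h d <->
  exists t w, [/\ uniformizer j x y R t, local_unit R w & h = w * t ^ d].
Proof.
split=> [[t [w [tu w0 wl wVl ->]]]|[t [w [tu wu ->]]]]; exists t, w; split=> //.
- exact: (chart_unitP (chart_eq R) (@chart_free R) (center_eq R)).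
- exact: (chart_unit_neq0 (chart_eq R) (@chart_free R) (center_eq R) wu).
- exact: chart_unit_local wu.
- exact/chart_unit_local/chart_unitV.
Qed.

(* The divisor of [coordinate Q] is that of x - x(Q), or 0 if Q is at infinity;
   at a point R it is compared with [scale_at R], whose m-th power is a local
   generator at R of the pullback of O(m) by x. *)
Definition coordinate (Q : point_on) : L :=
  match val Q with Aff a _ => x - j a | Infty _ => 1 end.

Definition scale_at (R : point_on) : L :=
  match val R with Aff _ _ => 1 | Infty _ => x end.

(** The double covering x is ramified at Q, so x - x(Q), or 1/x at infinity, has a double zero
    there; away from Q the quotient is a unit. *)
Lemma coordinate_order (R Q : point_on) (t : L) : weierstrass Q -> uniformizer j x y R t ->
  exists2 w, local_unit R w & coordinate Q / scale_at R = w * t ^+ (R == Q).*2.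
Proof.
move=> Qw tu.
have unit_ev (p : {poly K}) : p.[(center R).1] != 0 -> local_unit R (map_poly j p).[(chart x y R).1].
  by move=> pc; rewrite -eval2_inC; apply: chart_unit_eval; rewrite eval2C.
have ramified : R = Q ->
    exists2 w, local_unit R w & (chart x y R).1 - j (center R).1 = w * t ^+ (R == Q).*2.
  move=> RQ; rewrite RQ eqxx -{}RQ in Qw *.
  have c2 := (weierstrassP R).1 Qw; have [F1 F1E F1c] := weierstrass_simple_root Qw.
  have [w1 w1u ->] := ramified_sqr (chart_eq R) (@chart_free R) (center_eq R) F1E F1c.
  have [w2 w2u ->] := uniformizer_unique (chart_eq R) (@chart_free R) (center_eq R)
    (uniformizer_ramified (chart_eq R) (@chart_free R) (center_eq R) c2 F1E F1c) tu.
  exists (w1 * w2 ^+ 2); last by rewrite exprMn mulrA.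
  by apply: chart_unitM w1u _; exact: chart_unitX.
have unramified w : R != Q -> local_unit R w ->
    exists2 w', local_unit R w' & w = w' * t ^+ (R == Q).*2.
  by move=> /negPf -> wu; exists w; rewrite ?mulr1.
have Qc := (weierstrassP Q).1 Qw.
case ER : (val R) => [a b|s]; case EQ : (val Q) => [a' b'|s'].
- have b'0 : b' = 0 by move: Qc; rewrite /center EQ.
  have e : coordinate Q / scale_at R = x - j a' by rewrite /coordinate /scale_at ER EQ divr1.
  rewrite e; have [aa|aa] := eqVneq a a'.
    have RQ : R = Q.
      apply: val_inj; rewrite ER EQ b'0; congr (Aff _ _) => //.
      have := valP R; have := valP Q; rewrite ER EQ /= b'0 expr0n /= aa => /eqP <-.
      by rewrite expf_eq0 => /eqP.
    by have := ramified RQ; rewrite /chart /center ER aa.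
  apply: unramified; first by apply: contra_neq aa => RQ; move: ER; rewrite RQ EQ => -[->].
  have := unit_ev ('X - a'%:P); rewrite /center /chart ER /= map_polyXsubC !hornerXsubC subr_eq0.
  exact.
- apply: unramified; first by apply/eqP => RQ; rewrite RQ EQ in ER.
  have -> : coordinate Q / scale_at R = 1 by rewrite /coordinate /scale_at ER EQ divr1.
  by have := unit_ev 1; rewrite rmorph1 !hornerC => /(_ (oner_neq0 _)).
- apply: unramified; first by apply/eqP => RQ; rewrite RQ EQ in ER.
  have -> : coordinate Q / scale_at R = (map_poly j (1 - a' *: 'X)).[(chart x y R).1].
    rewrite /coordinate /scale_at /chart ER EQ rmorphB rmorph1 /= map_polyZ map_polyX.
    rewrite hornerD hornerN hornerC hornerZ hornerX mulrBl divff ?x_neq0 //.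
  apply: unit_ev; rewrite /center ER /= hornerD hornerN hornerC hornerZ hornerX mulr0 subr0.
  exact: oner_neq0.
- have s'0 : s' = 0 by move: Qc; rewrite /center EQ.
  have RQ : R = Q.
    apply: val_inj; rewrite ER EQ s'0; congr (Infty _).
    have := valP R; have := valP Q; rewrite ER EQ /= s'0 expr0n /= => /eqP <-.
    by rewrite expf_eq0 => /eqP.
  have -> : coordinate Q / scale_at R = (chart x y R).1 - j (center R).1.
    by rewrite /coordinate /scale_at /chart /center ER EQ /= rmorph0 subr0 div1r.
  exact: ramified.
Qed.

Lemma coordinate_neq0 (Q : point_on) : coordinate Q != 0.
Proof.
rewrite /coordinate; case: (val Q) => [a b|s]; last exact: oner_neq0.
apply/eqP => e; have := @ev_eq0 ('X - a%:P); rewrite map_polyXsubC hornerXsubC.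
by move=> /(_ e)/eqP; rewrite polyXsubC_eq0.
Qed.

Lemma scale_at_neq0 (R : point_on) : scale_at R != 0.
Proof. by rewrite /scale_at; case: (val R) => [a b|s]; rewrite ?oner_neq0 ?x_neq0. Qed.

End HyperellipticCurve.

(** * Torsion points *)

Lemma closed_sqrt (K : closedFieldType) (a : K) : exists b, b ^+ 2 = a.
Proof.
have /closed_rootP[b /rootP] : size ('X^2 - a%:P : {poly K}) != 1%N by rewrite size_XnsubC.
by rewrite hornerD hornerN hornerXn hornerC => /eqP; rewrite subr_eq0 => /eqP; exists b.
Qed.

(** The norm A^2 - F B^2 at a is the product of the values of A + B y at the two points above a, so
    one of them vanishes with it. *)
Lemma zero_on_fibre (K : closedFieldType) (F A B : {poly K}) (a : K) :
  A.[a] ^+ 2 = F.[a] * B.[a] ^+ 2 -> exists2 b, b ^+ 2 = F.[a] & A.[a] + B.[a] * b = 0.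
Proof.
move=> AB; have [B0|B0] := eqVneq B.[a] 0.
  have [b bE] := closed_sqrt F.[a]; exists b => //.
  move: AB; rewrite B0 expr0n /= mulr0 => /eqP; rewrite expf_eq0 => /eqP ->.
  by rewrite mul0r addr0.
exists (- (A.[a] / B.[a])); last by rewrite mulrN mulrC divfK // subrr.
by rewrite sqrrN expr_div_n AB mulfK // expf_neq0.
Qed.

Section Torsion.
Variables (g : nat) (K : closedFieldType) (L : fieldType) (j : {rmorphism K -> L}).
Variables (f : {poly K}) (x y : L).
Hypotheses (K_char0 : [pchar K] =i pred0) (f_hyp : hyperelliptic_poly g f).
Hypothesis L_ff : is_function_field j f x y.
Local Notation n := g.+1.*2.
Local Notation point_on := (curve g f).
Local Notation local_unit R h := (chart_unit j (chart x y R) (center R) h).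
Local Notation ev p := ((map_poly j p).[x]).

Lemma coeff_abel_jacobi (W P R : point_on) (m : nat) :
  coeff R (abel_jacobi W P *+ m) = ((R == P) * m)%N%:Z - ((R == W) * m)%N%:Z.
Proof.
have e (b : bool) : b%:R *+ m = (b * m)%N%:Z by rewrite -mulrnA natz.
by rewrite /abel_jacobi coeffMn coeffB !coeffU !mul1r ![_ == R]eq_sym mulrnBl !e.
Qed.

(** 2 (P - W) is the divisor of (x - x(P)) / (x - x(W)), where the factor of a point at infinity is
    1. *)
Lemma torsion_of_weierstrass (W P : point_on) : weierstrass W -> weierstrass P ->
  jacobian_torsion j x y (abel_jacobi W P).
Proof.
move=> Ww Pw; split; first by rewrite /abel_jacobi degB !degU subrr.
exists 2 => //; exists (coordinate j x P / coordinate j x W).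
  by rewrite mulf_neq0 ?invr_eq0 ?(coordinate_neq0 L_ff).
move=> R; apply/(has_orderP f_hyp L_ff).
have [t tu] := uniformizer_exists K_char0 f_hyp L_ff R.
have t0 : t != 0.
  exact: (uniformizer_neq0 (chart_free f_hyp L_ff (P := R)) tu).
have [w wu wE] := coordinate_order K_char0 f_hyp L_ff Pw tu.
have [w' wu' wE'] := coordinate_order K_char0 f_hyp L_ff Ww tu.
exists t, (w / w'); split=> //; first exact/chart_unitM/chart_unitV.
rewrite coeff_abel_jacobi !muln2 expfzDr // -exprnN -exprnP.
have w'0 := chart_unit_neq0 (chart_eq f_hyp L_ff R) (chart_free f_hyp L_ff (P := R)) (center_eq R) wu'.
have s0 := scale_at_neq0 L_ff R; have cW0 := coordinate_neq0 L_ff W.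
have tW0 : t ^+ (R == W).*2 != 0 by rewrite expf_neq0.
have -> : coordinate j x P / coordinate j x W
  = (coordinate j x P / scale_at x R) / (coordinate j x W / scale_at x R) by field; rewrite s0 cW0.
rewrite wE wE'; move: (t ^+ (R == W).*2) tW0 => T T0; move: (t ^+ _) => T'.
by field; rewrite w'0 T0.
Qed.

(** The denominators of h in K[x] are stable under remainders and have no common root by
    [common_denominator], so Euclidean descent ends at a nonzero constant. *)
Lemma affine_integral (h : L) :
  (forall a b, b ^+ 2 = f.[a] -> chart_local j (x, y) (a, b) h) ->
  exists A B, h = ev A + ev B * y.
Proof.
move=> hl; pose den (D : {poly K}) := exists A B, ev D * h = ev A + ev B * y.
have denP a : exists2 D, D.[a] != 0 & den D.
  have [b bE] := closed_sqrt f.[a].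
  have bNE : (- b) ^+ 2 = f.[a] by rewrite sqrrN.
  have [D [A [B [Da DE]]]] := common_denominator (z := (x, y)) (ff_equation L_ff)
    (affine_free f_hyp L_ff) bE (hl _ _ bE) (hl _ _ bNE).
  by exists D => //; exists A, B.
have den_mod D D' : den D -> den D' -> den (D' %% D).
  move=> [A [B DE]] [A' [B' DE']].
  exists (A' - D' %/ D * A), (B' - D' %/ D * B).
  have -> : D' %% D = D' - D' %/ D * D by rewrite [X in X - _](divp_eq D' D) addrC addKr.
  rewrite !(rmorphB, rmorphM) !(hornerD, hornerN, hornerM) mulrBl -mulrA DE DE'.
  by ring.
have [D0 D0a D0d] := denP 0.
have D00 : D0 != 0 by apply: contraNneq D0a => ->; rewrite horner0.
have [s] := ubnP (size D0); elim: s D0 {D0a} D00 D0d => // s IH D D_neq0 Dd sD.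
have [/size_poly1P[k k0 DE]|/closed_rootP[a Da]] := boolP (size D == 1%N).
  have [A [B]] := Dd; rewrite DE map_polyC hornerC => hE.
  have jk0 : j k != 0 by rewrite fmorph_eq0.
  exists (k^-1 *: A), (k^-1 *: B); rewrite !map_polyZ !hornerZ -mulrA -mulrDr -hE.
  by rewrite fmorphV mulKf.
have [D' D'a D'd] := denP a.
apply: (IH (D' %% D)); [|exact: den_mod|].
  apply: contraNneq D'a => /eqP DD'.
  have [q ->] := dvdpP _ _ (DD' : D %| D').
  by rewrite hornerM (rootP Da) mulr0.
by apply: leq_trans (ltn_modpN0 _ D_neq0) _; rewrite -ltnS.
Qed.

Local Notation u := (x^-1).
Local Notation v := (y / x ^+ g.+1).

(** Regularity at infinity gives a denominator D in 1/x with D(0) nonzero. Its reciprocal then has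
    full degree N, and comparing degrees in two polynomial identities bounds A and B. *)
Lemma pole_bounds (m : nat) (A B : {poly K}) :
  (forall s, s ^+ 2 = f`_n -> chart_local j (u, v) (0, s) ((ev A + ev B * y) / x ^+ m)) ->
  (size A <= m.+1)%N /\ (size B <= m - g)%N.
Proof.
move=> hl; have x0 := x_neq0 L_ff.
have [s sE] := closed_sqrt f`_n; have sNE : (- s) ^+ 2 = f`_n by rewrite sqrrN.
have sE' : s ^+ 2 = (reciprocal n f).[0] by rewrite horner0_reciprocal.
have [D [A1 [B1 [/= D0 DE]]]] := common_denominator (z := (u, v)) (infinity_eq f_hyp L_ff)
  (infinity_free f_hyp L_ff) sE' (hl _ sE) (hl _ sNE).
pose N := maxn (size D) (maxn (size A1) (size B1)).
have sD : (size D <= N.+1)%N by rewrite leqW // leq_maxl.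
have sA1 : (size A1 <= N.+1)%N by rewrite leqW // leq_max leq_maxl orbT.
have sB1 : (size B1 <= N.+1)%N by rewrite leqW // leq_max leq_maxr orbT.
have [|/eqP eA /eqP eB] := affine_free f_hyp L_ff (p0 := reciprocal N D * A * 'X^(g.+1) - reciprocal N A1 * 'X^(m + g.+1))
  (p1 := reciprocal N D * B * 'X^(g.+1) - reciprocal N B1 * 'X^m).
  rewrite !(rmorphB, rmorphM) /= !map_polyXn !(hornerD, hornerN, hornerM, hornerXn).
  rewrite -!(ev_reciprocal L_ff) // exprD.
  have xg0 : x ^+ g.+1 != 0 by rewrite expf_neq0.
  have xm0 : x ^+ m != 0 by rewrite expf_neq0.
  move: DE; move: (x ^+ g.+1) (x ^+ m) (x ^+ N) xg0 xm0 => Xg Xm XN xg0 xm0 DE.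
  move: ((map_poly j D).[u]) ((map_poly j A1).[u]) ((map_poly j B1).[u]) DE => d a1 b1 DE.
  have {}DE : d * (ev A + ev B * y) * Xg = Xm * (a1 * Xg + b1 * y).
    have -> : d * (ev A + ev B * y) * Xg = d * ((ev A + ev B * y) / Xm) * (Xm * Xg) by field.
    by rewrite DE; field.
  have E' X Y : d * XN * X * Xg - a1 * XN * (Xm * Xg) + (d * XN * Y * Xg - b1 * XN * Xm) * y
    = XN * (d * (X + Y * y) * Xg - Xm * (a1 * Xg + b1 * y)) by ring.
  by rewrite E' DE subrr mulr0.
move: eA eB; rewrite !subr_eq0 => /eqP eA /eqP eB.
have sRD : size (reciprocal N D) = N.+1.
  apply/eqP; rewrite eqn_leq size_reciprocal ltnNge; apply/negP => h.
  by move: D0; rewrite horner_coef0 -(subnn N) -coef_reciprocal // nth_default ?eqxx.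
have RD0 : reciprocal N D != 0 by rewrite -size_poly_gt0 sRD.
have sXn (p : {poly K}) k : (size (p * 'X^k)%R <= k + size p)%N.
  have [->|p0] := eqVneq p 0; first by rewrite mul0r size_poly0.
  by rewrite size_mulXn.
split.
  have [->|A0] := eqVneq A 0; first by rewrite size_poly0.
  have : size (reciprocal N D * A * 'X^(g.+1)) = (g.+1 + (N + size A))%N.
    by rewrite size_mulXn ?mulf_neq0 // size_mul // sRD.
  have := leq_trans (sXn (reciprocal N A1) (m + g.+1)%N) (leq_add (leqnn _) (size_reciprocal N A1)).
  rewrite -eA; set a := size _; set b := size _; clearbody a b; clear; lia.
have [->|B0] := eqVneq B 0; first by rewrite size_poly0.
have : size (reciprocal N D * B * 'X^(g.+1)) = (g.+1 + (N + size B))%N.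
  by rewrite size_mulXn ?mulf_neq0 // size_mul // sRD.
have := leq_trans (sXn (reciprocal N B1) m) (leq_add (leqnn _) (size_reciprocal N B1)).
rewrite -eB; set a := size _; set b := size _; clearbody a b; clear; lia.
Qed.

Lemma infinity_expansion (m : nat) (A B : {poly K}) :
  (size A <= m.+1)%N -> (size B <= m - g)%N ->
  (ev A + ev B * y) / x ^+ m
  = (map_poly j (reciprocal m A)).[u] + (map_poly j (reciprocal (m - g.+1) B)).[u] * v.
Proof.
move=> sA sB; have x0 := x_neq0 L_ff.
have eA := ev_reciprocal L_ff (size_reciprocal m A); rewrite reciprocalK // in eA.
rewrite -eA; have xm0 : x ^+ m != 0 by rewrite expf_neq0.
have [->|B0] := eqVneq B 0.
  by rewrite /reciprocal moebius0 !rmorph0 !horner0 !mul0r !addr0 mulfK.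
have gm : (g < m)%N.
  rewrite ltnNge; apply: contra B0 => le; rewrite -size_poly_leq0 (leq_trans sB) //.
  by rewrite leq_subLR addn0.
have eB := ev_reciprocal L_ff (size_reciprocal (m - g.+1) B).
rewrite reciprocalK ?subnSK // in eB.
rewrite -eB mulrDl mulfK //; congr (_ + _).
have -> : x ^+ m = x ^+ (m - g.+1) * x ^+ g.+1 by rewrite -exprD subnK.
have h1 : x ^+ (m - g.+1) != 0 by rewrite expf_neq0.
have h2 : x ^+ g.+1 != 0 by rewrite expf_neq0.
by move: (x ^+ (m - g.+1)) (x ^+ g.+1) h1 h2 => a b a0 b0; field; rewrite a0 b0.
Qed.

Lemma torsion_equation (W P : point_on) : weierstrass W -> ~ weierstrass P ->
  jacobian_torsion j x y (abel_jacobi W P) ->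
  exists m c (A B l : {poly K}),
    [/\ (0 < m)%N, c != 0, (size A <= m.+1)%N, (size B <= m - g)%N
      & A ^+ 2 - f * B ^+ 2 = c%:P * l ^+ m.*2
        /\ ((exists2 a, l = 'X - a%:P & A.[a] != 0) \/ (l = 1 /\ A`_m != 0))].
Proof.
move=> Ww Pw [_ [m m_gt0 [h _ h_ord]]].
(* h^2 has divisor 2m (P - W), and the second factor contributes 2m W relative to [scale_at]: only a
   zero of order 2m at P remains. *)
pose h1 := h ^+ 2 * coordinate j x W ^+ m.
have h1_ord (R : point_on) : exists t w, [/\ uniformizer j x y R t, local_unit R w
    & h1 / scale_at x R ^+ m = w * t ^+ ((R == P) * m.*2)].
  have [t [w [tu wu hE]]] := (has_orderP f_hyp L_ff R h _).1 (h_ord R).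
  have t0 : t != 0 by exact: (uniformizer_neq0 (chart_free f_hyp L_ff (P := R)) tu).
  have [w' wu' wE'] := coordinate_order K_char0 f_hyp L_ff Ww tu.
  exists t, (w ^+ 2 * w' ^+ m); split=> //.
    by apply: chart_unitM; apply: chart_unitX.
  have -> : h1 / scale_at x R ^+ m = h ^+ 2 * (coordinate j x W / scale_at x R) ^+ m.
    by rewrite /h1 expr_div_n mulrA.
  have -> : t ^+ ((R == P) * m.*2) = (t ^+ ((R == P) * m)) ^+ 2 by rewrite -exprM -mulnA muln2.
  have eW : (t ^+ (R == W).*2) ^+ m = (t ^+ ((R == W) * m)) ^+ 2.
    by rewrite -!exprM -muln2 mulnAC.
  rewrite wE' hE coeff_abel_jacobi expfzDr // -exprnN -exprnP [(w' * _) ^+ m]exprMn eW.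
  have tW0 : t ^+ ((R == W) * m) != 0 by rewrite expf_neq0.
  move: (t ^+ ((R == W) * m)) tW0 (t ^+ ((R == P) * m)) (w' ^+ m) => T T0 T' V.
  by field.
have h1_unit (R : point_on) : R != P -> local_unit R (h1 / scale_at x R ^+ m).
  by move=> /negPf RP; have [t [w [_ wu ->]]] := h1_ord R; rewrite RP mul0n mulr1.
have h1_local (R : point_on) : chart_local j (chart x y R) (center R) (h1 / scale_at x R ^+ m).
  have [t [w [tu wu ->]]] := h1_ord R; apply: chart_localM; first exact: chart_unit_local.
  by apply: chart_localX; apply: chart_maximal_local; case: tu.
have [A [B hE]] : exists A B, h1 = ev A + ev B * y.
  apply: affine_integral => a b ab.
  have := h1_local (exist _ (Aff a b) (introT eqP ab)).
  by rewrite /scale_at /chart /center /= expr1n divr1.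
have [sA sB] : (size A <= m.+1)%N /\ (size B <= m - g)%N.
  apply: pole_bounds => s sE; rewrite -hE.
  exact: h1_local (exist _ (Infty s) (introT eqP sE)).
pose T : {poly K} := A ^+ 2 - f * B ^+ 2.
have zero_at (R : point_on) (p0 p1 : {poly K}) : R != P ->
    h1 / scale_at x R ^+ m = (map_poly j p0).[(chart x y R).1] + (map_poly j p1).[(chart x y R).1] * (chart x y R).2 ->
    p0.[(center R).1] + p1.[(center R).1] * (center R).2 <> 0.
  move=> RP e z; have := h1_unit R RP; rewrite e.
  have -> : (map_poly j p0).[(chart x y R).1] + (map_poly j p1).[(chart x y R).1] * (chart x y R).2
     = eval2_in j (p0%:P + p1%:P * 'X) (chart x y R).
    by rewrite eval2_inD eval2_inM !eval2_inC eval2_inX.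
  apply: (chart_maximal_nonunit (chart_eq f_hyp L_ff R) (chart_free f_hyp L_ff (P := R)) (center_eq R)).
  by rewrite eval2D eval2M !eval2C eval2X.
have zero_affine (a b : K) (ab : on_curve g f (Aff a b)) :
    A.[a] + B.[a] * b = 0 -> val P = Aff a b.
  move=> z; pose R : point_on := exist (on_curve g f) (Aff a b) ab.
  have [<- //|RP] := eqVneq R P; case: (zero_at R A B RP) => //.
  by rewrite /scale_at /chart /= expr1n divr1.
have zero_infinity (s : K) (sE : on_curve g f (Infty s)) :
    A`_m + B`_(m - g.+1) * s = 0 -> val P = Infty s.
  move=> z; pose R : point_on := exist (on_curve g f) (Infty s) sE.
  have [<- //|RP] := eqVneq R P.
  case: (zero_at R (reciprocal m A) (reciprocal (m - g.+1) B) RP).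
    by rewrite /scale_at /chart /= hE infinity_expansion.
  by rewrite /center /= !horner0_reciprocal.
(* A zero of the norm yields a zero of h1 in the same fibre of x, and P is the only zero. *)
have root_T a : root T a -> exists b, val P = Aff a b.
  rewrite /root /T hornerD hornerN (hornerM f) !horner_exp subr_eq0 => /eqP /zero_on_fibre[b bE z].
  by exists b; apply: zero_affine => //; apply/eqP.
have sf := size_hyperelliptic_poly f_hyp.
(* As a form of degree 2m, T vanishes at infinity when this coefficient does; the fibre argument
   then applies in the other chart. *)
have T_top : T`_m.*2 = A`_m ^+ 2 - f`_n * B`_(m - g.+1) ^+ 2.
  rewrite -horner0_reciprocal /T /reciprocal (@moebius_norm _ g) // -/(reciprocal m A).
  rewrite -/(reciprocal n f) -/(reciprocal (m - g.+1) B).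
  by rewrite hornerD hornerN (hornerM (reciprocal n f)) !horner_exp !horner0_reciprocal.
have sT : (size T <= m.*2.+1)%N.
  rewrite (leq_trans (size_polyD _ _)) // geq_max size_polyN; apply/andP; split.
    apply: leq_trans (size_poly_exp_leq _ _) _; move: sA; set a := size A; clearbody a.
    by clear; lia.
  have [->|B0] := eqVneq B 0; first by rewrite expr0n mulr0 size_poly0.
  apply: leq_trans (size_polyMleq _ _) _.
  have := size_poly_exp_leq B 2; move: sB sf; rewrite -size_poly_gt0 in B0.
  by move: B0; set a := size B; set b := size f; set c := size _; clearbody a b c; clear; lia.
have infinity_root : T`_m.*2 = 0 -> exists s, val P = Infty s.
  rewrite T_top => /eqP; rewrite subr_eq0 -!horner0_reciprocal => /eqP/zero_on_fibre[s sE z].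
  exists s; apply: zero_infinity; last by rewrite -!horner0_reciprocal.
  by apply/eqP; rewrite sE horner0_reciprocal.
have := valP P; case EP : (val P) => [a b|s] /eqP PE.
- have b0 : b != 0.
    by apply/eqP=> b0; apply: Pw; rewrite /weierstrass EP /= b0 oppr0.
  have T2m : T`_m.*2 != 0 by apply/eqP => /infinity_root[s]; rewrite EP.
  have sTE : size T = m.*2.+1.
    by apply/eqP; rewrite eqn_leq sT ltnNge; apply: contra T2m => /(nth_default 0) ->.
  have T0 : T != 0 by rewrite -size_poly_gt0 sTE.
  have [r TE] := closed_field_poly_normal T.
  have r_a z : z \in r -> z = a.
    move=> zr; have [|b'] := root_T z; last by rewrite EP => -[].
    by rewrite TE rootZ ?lead_coef_eq0 // root_prod_XsubC.
  have {}TE : T = lead_coef T *: ('X - a%:P) ^+ size r.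
    rewrite [LHS]TE; congr (_ *: _).
    rewrite (eq_big_seq (fun=> 'X - a%:P)) => [|z /r_a -> //].
    by rewrite big_const_seq count_predT iter_mulr_1.
  have sr : size r = m.*2.
    by have := sTE; rewrite TE size_scale ?lead_coef_eq0 // size_exp_XsubC => -[].
  exists m, (lead_coef T), A, B, ('X - a%:P); split=> //; first by rewrite lead_coef_eq0.
  split; first by rewrite mul_polyC -sr -TE.
  (* If A(a) = 0, then B(a) = 0 because b is nonzero, so h1 also vanishes at the conjugate point.
     That point must be P, which is then fixed by the involution. *)
  left; exists a => //; apply/eqP=> Aa.
  have : T.[a] = 0.
    by rewrite TE sr hornerZ horner_exp hornerXsubC subrr expr0n double_eq0 (gtn_eqF m_gt0) mulr0.
  rewrite /T hornerD hornerN (hornerM f) !horner_exp Aa expr0n /= sub0r => /eqP.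
  rewrite oppr_eq0 mulf_eq0 -PE !expf_eq0 /= (negPf b0) /= => /eqP Ba.
  have EP' : val P = Aff a (- b).
    by apply: zero_affine; rewrite ?Aa ?Ba ?mul0r ?addr0 // /on_curve sqrrN; apply/eqP.
  by apply: Pw; rewrite /weierstrass EP' /= -EP' EP opprK.
have s0 : s != 0.
  by apply/eqP=> s0; apply: Pw; rewrite /weierstrass EP /= s0 oppr0.
(* With P at infinity, T has no affine root and is a nonzero constant; l = 1 is the linear form
   vanishing at infinity. *)
have [/size_poly1P[c c0 TE]|/closed_rootP[a /root_T[b]]] := boolP (size T == 1%N); last by rewrite EP.
exists m, c, A, B, 1; split=> //; split; first by rewrite expr1n mulr1.
right; split=> //; apply/eqP=> Am.
move: T_top; rewrite TE coefC double_eq0 (gtn_eqF m_gt0) Am expr0n /= sub0r => /esym/eqP.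
rewrite oppr_eq0 mulf_eq0 -PE !expf_eq0 /= (negPf s0) /= => /eqP Bm.
have EP' : val P = Infty (- s).
  by apply: zero_infinity; rewrite ?Am ?Bm ?mul0r ?addr0 // /on_curve sqrrN; apply/eqP.
by apply: Pw; rewrite /weierstrass EP' /= -EP' EP opprK.
Qed.

End Torsion.

Theorem theorem7p1 (g : nat) (k : fieldType) (f : {poly k})
    (kbar : closedFieldType) (iota : {rmorphism k -> kbar})
    (L : fieldType) (j : {rmorphism kbar -> L}) (x y : L)
    (W : curve g f)
    (g_gt1 : (1 < g)%N)
    (k_char0 : [pchar k] =i pred0)
    (f_hyperelliptic : hyperelliptic_poly g f)
    (f_generic : generic g f)
    (kbar_algebraic : forall z : kbar, algebraicOver iota z)
    (L_function_field : is_function_field j (map_poly iota f) x y)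
    (W_weierstrass : weierstrass W) :
  forall P : curve g (map_poly iota f),
    jacobian_torsion j x y (abel_jacobi (base_change iota W) P)
    <-> weierstrass P.
Proof.
have kbar_char0 : [pchar kbar] =i pred0 by move=> p; rewrite (fmorph_pchar iota) k_char0.
have fbar_hyp : hyperelliptic_poly g (map_poly iota f).
  by case: f_hyperelliptic => sf sepf; rewrite /hyperelliptic_poly size_map_poly separable_map.
have Ww : weierstrass (base_change iota W).
  move: W_weierstrass; rewrite /weierstrass /=.
  by case: (val W) => [a b|s] /= [e]; rewrite -rmorphN e.
move=> P; split=> [Ptors|Pw]; last exact: torsion_of_weierstrass.
case: (eqVneq (hyperelliptic_involution (val P)) (val P)) => // Pw.
have {}Pw : ~ weierstrass P by move=> e; rewrite e eqxx in Pw.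
have [m [c [A [B [l [m_gt0 c0 sA sB [norm_eq l_root]]]]]]] :=
  torsion_equation kbar_char0 fbar_hyp L_function_field Ww Pw Ptors.
have sf : (size f <= g.+1.*2.+1)%N by case: f_hyperelliptic => [[/eqP->|/eqP->]].
by case: (no_generic_torsion_equation g_gt1 k_char0 sf f_generic m_gt0 c0 sA sB norm_eq l_root).
Qed.
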